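(* Let $G=(V,E)$ be a connected regular graph (possibly infinite) of degree $\Delta$, rooted at $0$, and let $\mathbf X$ be the continuous-time random walk in i.i.d. Dirichlet random environment on $G$ started at $0$, where for each vertex $i$ the vector $(\omega(i,j))_{j\sim i}$ has constant density $\Gamma(\Delta)$ on the $(\Delta-1)$-dimensional simplex; let $\mathsf P$ be the annealed law. Fix a finite connected subgraph $G'=(V',E')$ of $G$ with $0\in V'$, a vertex $i_1\in V'$, a time $t>0$, and $k\in\mathbb N^{\vec E'}$ with $b(k)_i=\delta_0(i)-\delta_{i_1}(i)$ for all $i\in V'$. Let $\vec{\mathcal T}_{i_1}(G')$ be the collection of oriented spanning trees of $G'$ rooted at $i_1$. Then, for $\ell\in(0,\infty)^{V'}$ with $\sum_i\ell_i=t$, $$\mathsf P\bigl(k(\mathbf X,t)=k,\ \ell(\mathbf X,t)\in(\ell,\ell+d\ell),\ X_t=i_1\bigr)=e^{-t}\,\Gamma(\Delta)^{|V'|}\left(\prod_{i\in V'}\frac{\ell_i^{k_i-1}}{\Gamma(k_i+\Delta)}\right)\ell_{i_1}\left(\sum_{\vec T\in\vec{\mathcal T}_{i_1}(G')}\ \prod_{(i,j)\in\vec T}k_{i,j}\right)m_t(d\ell).$$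
   Context: $\mathbb N=\{0,1,2,\dots\}$, $\delta_i(j)=\mathbf 1_{\{i=j\}}$. $\vec E$, $\vec E'$ are the sets of both orientations of the edges of $E$, $E'$. The vectors $(\omega(i,j))_{j\sim i}$, $i\in V$, are independent. Given $\omega$, under the quenched law $P_\omega$, $\mathbf X$ is the continuous-time Markov chain with $X_0=0$ jumping from $u$ to a neighbour $v$ at rate $\omega(u,v)$; $\mathsf P$ is the average of $P_\omega$ over $\omega$. For $k\in\mathbb N^{\vec E'}$ (extended by $0$ to $\vec E$): $k_i=\sum_{j\sim i}k_{i,j}$, $b(k)_{i,j}=k_{i,j}-k_{j,i}$, $b(k)_i=\sum_{j\sim i}b(k)_{i,j}$. Oriented spanning trees rooted at $i_1$ have their edges oriented towards $i_1$ (one tree edge leaves each vertex $\neq i_1$, none leaves $i_1$). $k_{i,j}(\mathbf X,t)$ is the number of jumps from $i$ to $j$ up to time $t$ (the event $k(\mathbf X,t)=k$ includes that no edge outside $\vec E'$ is crossed) and $\ell(\mathbf X,t)_i=\int_0^t\mathbf 1_{\{X_s=i\}}ds$. $m_t$ is Lebesgue measure on the simplex $\{\ell\in(0,\infty)^{V'}:\sum_i\ell_i=t\}$ parametrised by $(\ell_i)_{i\ne i_1}$ (unit point mass if $V'=\{i_1\}$); the identity is an equality of measures in $\ell$. *)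

(* Defs.v *)
From HB Require Import structures.
From mathcomp Require Import all_boot all_order all_algebra finmap.
From mathcomp Require Import all_classical all_reals all_analysis.
From mathcomp Require Import measurable_realfun.

Set Implicit Arguments.
Unset Strict Implicit.
Unset Printing Implicit Defensive.

Import Order.TTheory GRing.Theory Num.Theory numFieldNormedType.Exports.
Local Open Scope classical_set_scope.
Local Open Scope ring_scope.

(* A locally finite simple graph on V is given by its neighbour sets: j ~ i iff
   j \in nbrs i *)
Section graphs.
Variable V : choiceType.

Definition simple_graph (nbrs : V -> {fset V}) : Prop :=
  (forall i, i \notin nbrs i) /\ (forall i j, (i \in nbrs j) = (j \in nbrs i)).

Definition regular_graph (nbrs : V -> {fset V}) (Delta : nat) : Prop :=
  forall i, #|` nbrs i| = Delta.

Definition graph_rel (nbrs : V -> {fset V}) : rel V := fun i j => j \in nbrs i.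

Definition connected_on (A : {pred V}) (e : rel V) : Prop :=
  forall i j, i \in A -> j \in A -> exists2 p, path e i p & last i p = j.

Definition subgraph (nbrs : V -> {fset V}) (V' : {fset V}) (E' : rel V) : Prop :=
  symmetric E' /\ forall i j, E' i j -> [/\ i \in V', j \in V' & j \in nbrs i].

Definition out_total (nbrs : V -> {fset V}) (k : V -> V -> nat) (i : V) : nat :=
  (\sum_(j <- nbrs i) k i j)%N.

Definition divergence (nbrs : V -> {fset V}) (k : V -> V -> nat) (i : V) : int :=
  \sum_(j <- nbrs i) ((k i j)%:Z - (k j i)%:Z).

End graphs.

(* For the edge set e on I: T is a set of arcs of e whose underlying undirected
   graph is a spanning tree, with one arc leaving each vertex other than r and
   none leaving r. The size bound on simple cycles discards i, j, i. *)
Definition oriented_spanning_tree (I : finType) (e : rel I) (r : I)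
    (T : {set I * I}) : Prop :=
  let u : rel I := [rel i j | ((i, j) \in T) || ((j, i) \in T)] in
  [/\ forall i j, (i, j) \in T -> e i j,
      forall i j, connect u i j,
      forall c : seq I, ucycle u c -> (size c <= 2)%N
    & forall i, #|[set j | (i, j) \in T]| = (i != r) :> nat].

Definition Gamma (R : realType) (s : R) : R :=
  \int[lebesgue_measure]_(x in `]0, +oo[) (x `^ (s - 1) * expR (- x)).

(* Vectors of R^I are represented by tuples, coordinate i being at position
   enum_rank i *)
Definition vec (R : Type) (I : finType) (f : I -> R) : #|I|.-tuple R :=
  [tuple f (enum_val a) | a < #|I|].

Definition vcoord (R : Type) (I : finType) (x : #|I|.-tuple R) (i : I) : R :=
  tnth x (enum_rank i).

(* The measure structure of pushforward m f, which canonical structures cannot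
   infer because it depends on mf *)
Definition image_measure (d1 d2 : measure_display)
    (T1 : measurableType d1) (T2 : measurableType d2) (R : realType)
    (m : {measure set T1 -> \bar R}) (f : T1 -> T2)
    (mf : measurable_fun setT f) : {measure set T2 -> \bar R} :=
  measure_function_pushforward__canonical__measure_function_Measure m mf.

Section lebesgue_tuple.
Variable R : realType.

Definition tcons n (p : measurableTypeR R * n.-tuple R) : n.+1.-tuple R :=
  [tuple of p.1 :: p.2].

Lemma measurable_tcons n : measurable_fun setT (@tcons n).
Proof. by apply: measurable_cons; [exact: measurable_fst|exact: measurable_snd]. Qed.

Section pushforward_tcons.
Context n (m : {sigma_finite_measure set (n.-tuple R) -> \bar R}).

Definition lebesgue_tcons : set (n.+1.-tuple R) -> \bar R :=
  pushforward (@lebesgue_measure R \x m)%E (@tcons n).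

Let lebesgue_tcons0 : lebesgue_tcons set0 = 0%E.
Proof. exact: (measure0 (image_measure _ (@measurable_tcons n))). Qed.

Let lebesgue_tcons_ge0 A : (0 <= lebesgue_tcons A)%E.
Proof. exact: (measure_ge0 (image_measure _ (@measurable_tcons n))). Qed.

Let lebesgue_tcons_sigma_additive : semi_sigma_additive lebesgue_tcons.
Proof.
exact: (@measure_semi_sigma_additive _ _ _
  (image_measure _ (@measurable_tcons n))).
Qed.

HB.instance Definition _ := isMeasure.Build _ _ _ lebesgue_tcons
  lebesgue_tcons0 lebesgue_tcons_ge0 lebesgue_tcons_sigma_additive.

End pushforward_tcons.

Lemma lebesgue_tcons_sigma_finite n m : sigma_finite setT (@lebesgue_tcons n m).
Proof.
have /sigma_finiteP[F [TF ndF Foo]] := sigma_finiteT (@lebesgue_measure R).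
have /sigma_finiteP[G [TG ndG Goo]] := sigma_finiteT m.
pose g (x : n.+1.-tuple R) : measurableTypeR R * n.-tuple R :=
  (thead x, [tuple of behead x]).
have gK : cancel (@tcons n) g by case=> a x; congr pair; apply: val_inj.
have mg : measurable_fun setT g.
  by apply/measurable_fun_pair; [exact: measurable_tnth|exact: measurable_behead].
exists (fun i => g @^-1` (F i `*` G i)).
  apply/esym; rewrite -subTset => x _.
  have [i _ Fi] : (\bigcup_i F i) (g x).1 by rewrite -TF.
  have [j _ Gj] : (\bigcup_i G i) (g x).2 by rewrite -TG.
  exists (maxn i j) => //; split.
    by move: Fi; exact/subsetPset/ndF/leq_maxl.
  by move: Gj; exact/subsetPset/ndG/leq_maxr.
move=> i; have [mF Fi] := Foo i; have [mG Gi] := Goo i; split.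
  by rewrite -[X in measurable X]setTI; apply: mg => //; exact: measurableX.
rewrite /lebesgue_tcons /pushforward -comp_preimage.
rewrite (_ : g \o _ = id); last by apply/funext => x /=; exact: gK.
by rewrite preimage_id product_measure1E// lte_mul_pinfty// ge0_fin_numE.
Qed.

HB.instance Definition _ n m := Measure_isSigmaFinite.Build _ _ _
  (@lebesgue_tcons n m) (@lebesgue_tcons_sigma_finite n m).

Fixpoint lebesgue_tuple n : {sigma_finite_measure set (n.-tuple R) -> \bar R} :=
  match n with
  | 0 => dirac ([tuple] : 0.-tuple R)
  | n.+1 => lebesgue_tcons (lebesgue_tuple n)
  end.

Definition hyperplane_point n (h : 'I_n) (t : R) (x : n.-1.-tuple R) :
    n.-tuple R :=
  [tuple if unlift h i is Some j then tnth x j else t - \sum_j tnth x j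
     | i < n].

Lemma measurable_hyperplane_point n (h : 'I_n) t :
  measurable_fun setT (@hyperplane_point n h t).
Proof.
apply/measurable_fun_tnthP => i.
rewrite (_ : _ \o _ = fun x : n.-1.-tuple R =>
  if unlift h i is Some j then tnth x j else t - \sum_j tnth x j); last first.
  by apply/funext => x /=; rewrite tnth_mktuple.
case: (unlift h i) => [j|]; first exact: measurable_tnth.
apply: measurable_funB => //; apply: measurable_sum => j; exact: measurable_tnth.
Qed.

Definition positive_orthant n : set (n.-tuple R) :=
  [set x | forall i, 0 < tnth x i].
Arguments positive_orthant : clear implicits.

Lemma measurable_positive_orthant n : measurable (positive_orthant n).
Proof.
rewrite (_ : positive_orthant n = \bigcap_(i in [set: 'I_n])
    ((fun x : n.-tuple R => tnth x i) @^-1` `]0, +oo[)).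
  apply: fin_bigcap_measurable => // i _.
  rewrite -[X in measurable X]setTI; apply: measurable_tnth => //.
apply/seteqP; split => x /= H i; first by move=> _; rewrite /= in_itv/= andbT.
by have := H i I; rewrite /= in_itv/= andbT.
Qed.

(* Lebesgue measure on the open simplex of positive vectors of R^n with sum t,
   parametrised by all the coordinates but the h-th; for n = 1 it is the unit
   point mass at (t), provided 0 < t *)
Definition simplex_measure n (h : 'I_n) (t : R) :=
  mrestr (image_measure (lebesgue_tuple n.-1)
                        (@measurable_hyperplane_point n h t))
         (@measurable_positive_orthant n).

HB.instance Definition _ n h t := Measure.on (@simplex_measure n h t).

End lebesgue_tuple.
Arguments positive_orthant : clear implicits.

Section random_walk.
Context (R : realType) (V : choiceType) (nbrs : V -> {fset V}).

(* The vectors (omega(i, j))_{j ~ i}, i in V, are independent, each with constant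
   density Gamma(Delta) on its simplex (whichever coordinate h is dropped in the
   parametrisation) *)
Definition dirichlet_environment (d : measure_display) (E : measurableType d)
    (P : probability E R) (Delta : nat) (omega : E -> V -> V -> R) : Prop :=
  let env i : E -> #|{: nbrs i}|.-tuple R :=
    fun e => vec (fun j : nbrs i => omega e i (val j)) in
  [/\ forall i, measurable_fun setT (env i),
      forall i (h : nbrs i) (B : set (#|{: nbrs i}|.-tuple R)), measurable B ->
        P (env i @^-1` B) =
        (\int[simplex_measure (enum_rank h) 1]_(x in B) (Gamma (Delta%:R : R))%:E)%E
    & forall (F : {fset V}) (B : forall i, set (#|{: nbrs i}|.-tuple R)),
        (forall i, measurable (B i)) ->
        P [set e | forall i, i \in F -> B i (env i e)] =
        (\prod_(i <- F) P (env i @^-1` B i))%E].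

Definition exit_rate (q : V -> V -> R) (u : V) : R := \sum_(v <- nbrs u) q u v.

Definition jump_prob (q : V -> V -> R) (u v : V) : R :=
  if v \in nbrs u then q u v / exit_rate q u else 0.

Definition jump_time (W : Type) (S : nat -> W -> R) (n : nat) (w : W) : R :=
  \sum_(m < n) S m w.

(* Under Q, X is a continuous-time Markov chain on the graph, started at x0 and
   jumping from u to a neighbour v at rate q u v: its jump chain Y is the Markov
   chain with transitions jump_prob q and, given Y, its holding times S are
   independent, S_m being exponential with parameter exit_rate q (Y_m). The
   chain has no absorbing state and, paths being step functions, no explosion. *)
Definition markov_jump_process (d : measure_display) (W : measurableType d)
    (Q : set W -> \bar R) (q : V -> V -> R) (x0 : V) (X : R -> W -> V) : Prop :=
  exists (Y : nat -> W -> V) (S : nat -> W -> R),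
  [/\ (forall n v, measurable (Y n @^-1` [set v])) /\
        (forall n, measurable_fun setT (S n)),
      forall n w, 0 < S n w,
      forall w s, exists n, s < jump_time S n w,
      forall n w s, jump_time S n w <= s < jump_time S n.+1 w -> X s w = Y n w
    & forall n (y : nat -> V) (s : nat -> R), (forall m, 0 <= s m) ->
        Q [set w | forall m, (m <= n)%N -> Y m w = y m /\ s m < S m w] =
        ((y 0%N == x0)%:R *
         (\prod_(m < n) jump_prob q (y m) (y m.+1)) *
         \prod_(m < n.+1) expR (- (exit_rate q (y m) * s m)))%:E].

Definition annealed (d d' : measure_display) (E : measurableType d)
    (W : measurableType d') (P : probability E R) (PW : R.-pker E ~> W)
    (A : set W) : \bar R :=
  (\int[P]_e PW e A)%E.

Variables (W : Type) (X : R -> W -> V) (t : R) (w : W).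

Definition jumps (i j : V) : set R :=
  [set s | [/\ 0 < s, s <= t, \forall r \near s^'-, X r w = i & X s w = j]].

Definition jump_counts_eq (k : V -> V -> nat) : Prop :=
  forall i j, j \in nbrs i -> (jumps i j #= `I_(k i j))%card.

Definition local_time (i : V) : R :=
  \int[lebesgue_measure]_(s in `[0, t]) (X s w == i)%:R.

End random_walk.

(* Main.v *)
(* Under the quenched law the rates out of each vertex sum to 1 almost surely, so
   the holding times are independent of the jump chain and i.i.d. exponential of
   parameter 1. A path from 0 to i_1 with step counts k thus has probability
   prod omega(i,j)^k_{i,j}, and given the path the times spent at the vertices up
   to t have density
     e^{-t} (prod_{i <> i_1} l_i^{k_i - 1} / (k_i - 1)!) l_{i_1}^{k_{i_1}} / k_{i_1}!
   on the simplex, which depends on the path only through k. The number of these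
   paths is given by the BEST theorem,
     #paths * prod k_{i,j}! = k_{i_1}! (prod_{i <> i_1} (k_i - 1)!) sum_T prod_T k,
   obtained by induction on the first step, because the tree polynomial is linear
   in each row of k. Averaging prod omega^k over the independent Dirichlet vectors
   gives Gamma(Delta) prod_j k_{i,j}! / Gamma(k_i + Delta) for each vertex i, so
   the factors k_{i,j}!, (k_i - 1)! and k_{i_1}! all cancel.
   If some i <> i_1 has k_i = 0, both sides vanish: a path with counts k spends no
   time at i, and no tree contributes. *)
Require Import Defs.
From HB Require Import structures.
From mathcomp Require Import all_boot all_order all_algebra finmap.
From mathcomp Require Import all_classical all_reals all_analysis.
From mathcomp Require Import measurable_realfun ring zify.

Set Implicit Arguments.
Unset Strict Implicit.
Unset Printing Implicit Defensive.

Import Order.TTheory GRing.Theory Num.Theory numFieldNormedType.Exports.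

(** * Counting trails with prescribed steps *)

(** The hypotheses give the holding times only through joint tails on path cylinders, so their law
    is recovered one step at a time, as an integral operator on functions of the occupation vector:
    a visit to [i] adds to coordinate [i] a duration integrated against Lebesgue measure, and all
    factors exp(-S) are collected into one function of the total time. These operators commute by
    Tonelli, which is why the order of the visits disappears, and repeated visits to a vertex
    collapse into one integral with weight u^a / a!. The same calculus gives the Dirichlet
    integrals. In the path count, the obstacle to the induction is a vertex whose steps are used up:
    its zero row would kill every tree. Such rows are redirected to the root, and the step that
    exhausts a vertex is treated separately. As V may be infinite, connectedness serves to encode
    finite paths by sequences of integers, which makes the event a countable union of cylinders. *)

Section best.
Variable I : finType.
Implicit Types (r o : I) (f : {ffun I -> I}) (k m : I -> I -> nat) (y : seq I).

(** Spanning trees oriented towards [r] are encoded by parent maps: [f i] is the head of the arc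
    leaving [i], and [r], which no arc leaves, is its own parent. *)
Definition tree_map r f := (f r == r) && [forall i, fconnect f i r].

Definition tree_weight r m : nat :=
  \sum_(f | tree_map r f) \prod_(i | i != r) m i (f i).

Lemma eq_tree_weight r m m' :
  (forall i j, i != r -> m i j = m' i j) -> tree_weight r m = tree_weight r m'.
Proof.
move=> mm; apply: eq_bigr => f _; apply: eq_bigr => i ir; exact: mm.
Qed.

Definition decr k o j : I -> I -> nat :=
  fun a b => k a b - ((a, b) == (o, j)).

Definition row k i := \sum_j k i j.
Definition col k i := \sum_j k j i.

(** Removing a step out of [o] affects only the factor of row [o]: with p = f(o), the map f
    contributes the sum over j of m_{o,j} (m_{o,p} - [p = j]), which is m_{o,p} times (row - 1). *)
Lemma sum_tree_weight_decr r o m : o != r ->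
  \sum_j m o j * tree_weight r (decr m o j) = (row m o).-1 * tree_weight r m.
Proof.
move=> or; rewrite /tree_weight big_distrr/=.
under eq_bigr do rewrite big_distrr/=.
rewrite exchange_big/=; apply: eq_bigr => f _.
pose c := \prod_(i | (i != r) && (i != o)) m i (f i).
rewrite [in RHS](bigD1 o)//= -/c [RHS]mulnA.
transitivity (\sum_j (m o j * (m o (f o) - (f o == j))) * c).
  apply: eq_bigr => j _; rewrite (bigD1 o)//= mulnA; congr (_ * _ * _).
    by rewrite /decr xpair_eqE eqxx eq_sym.
  by apply: eq_bigr => i /andP[_ /negPf io]; rewrite /decr xpair_eqE io subn0.
rewrite -big_distrl/= ; congr (_ * _).
rewrite (bigD1 (f o))//= eqxx /row.
under eq_bigr => j /negPf jf do rewrite eq_sym jf subn0.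
rewrite -big_distrl/= [in RHS](bigD1 (f o))//=.
(* If this entry is 0 both sides vanish; otherwise the truncated subtractions are exact. *)
set s := (X in _ + X * _); case: (m o (f o)) => [|a]; rewrite ?muln0//=; lia.
Qed.

Definition redirect f o j : {ffun I -> I} :=
  [ffun i => if i == o then j else f i].

(** As nothing maps to [o], orbits starting elsewhere never meet [o] and do not see the change. *)
Lemma tree_map_redirect r o j f : o != r -> j != o ->
  (forall i, f i != o) -> tree_map r f -> tree_map r (redirect f o j).
Proof.
move=> or jo fo /andP[fr /forallP ft]; apply/andP; split.
  by rewrite ffunE ifN// eq_sym.
have key n i : i != o -> iter n f i = iter n (redirect f o j) i /\
    iter n f i != o.
  move=> io; elim: n => [|n [IH1 IH2]]//=.
  by split; [rewrite -IH1 ffunE (negPf IH2)|exact: fo].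
have H i : i != o -> fconnect (redirect f o j) i r.
  move=> io; have /iter_findex <- := ft i.
  by rewrite (key _ _ io).1 fconnect_iter.
apply/forallP => i; have [->|] := eqVneq i o; last exact: H.
apply: connect_trans (H j jo); apply: connect1 => /=.
by rewrite ffunE eqxx.
Qed.

(* Nothing enters o, so o is a leaf of every tree of nonzero weight and only the
   total weight of its row matters. *)
Lemma tree_weight_leaf r o m j j' : o != r -> j != o -> j' != o ->
  (forall i, i != r -> m i o = 0) ->
  tree_weight r (fun a b => if a == o then (b == j : nat) else m a b) =
  tree_weight r (fun a b => if a == o then (b == j' : nat) else m a b).
Proof.
move: j j'; move=> j0 j0' or.
(* By symmetry an inequality is enough; redirecting [o] from [j1] to [j2] matches the trees of
   nonzero weight. *)
have gen j1 j2 : j1 != o -> j2 != o -> (forall i, i != r -> m i o = 0) ->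
  tree_weight r (fun a b => if a == o then (b == j1 : nat) else m a b) <=
  tree_weight r (fun a b => if a == o then (b == j2 : nat) else m a b).
  move=> j1o j2o mo.
  rewrite /tree_weight.
  (* Tree maps outside [P j] have weight 0: they attach [o] elsewhere than to [j], or use an arc
     into [o]. *)
  pose P j f := [&& tree_map r f, f o == j & [forall i, f i != o]].
  have red j f : j != o -> tree_map r f ->
      ~~ P j f -> \prod_(i | i != r)
        (if i == o then (f i == j : nat) else m i (f i)) = 0.
    move=> jo tf; rewrite /P tf/= negb_and => /orP[fj|].
      by rewrite (bigD1 o)//= eqxx (negPf fj).
    rewrite negb_forall => /existsP[i]; rewrite negbK => /eqP fi.
    have ir : i != r.
      apply/eqP => ir; move: tf => /andP[/eqP fr _]; move: or.
      by rewrite -fi ir fr eqxx.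
    rewrite (bigD1 i)//= fi; case: ifPn => [_|_]; last by rewrite mo.
    by rewrite eq_sym (negPf jo).
  rewrite (bigID (P j1))/= [X in _ + X <= _]big1 ?addn0; last first.
    by move=> f /andP[tf nP]; exact: red nP.
  rewrite [leqRHS](bigID (P j2))/= [X in _ <= _ + X]big1 ?addn0; last first.
    by move=> f /andP[tf nP]; exact: red nP.
  rewrite [leqRHS](reindex_onto (fun f => redirect f o j2) (fun f => redirect f o j1))/=;
    last first.
    move=> f /andP[tf /and3P[_ /eqP fo _]]; apply/ffunP => i; rewrite !ffunE.
    by case: eqP => // ->.
  rewrite big_mkcond [leqRHS]big_mkcond; apply: leq_sum => f _.
  case: ifPn => // /andP[tf /and3P[_ /eqP fo /forallP nf]].
  rewrite ifT; last first.
    have tf' := tree_map_redirect or j2o nf tf.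
    rewrite /P tf' ffunE !eqxx/=; apply/andP; split.
      by apply/forallP => i; rewrite ffunE; case: ifP.
    by apply/eqP/ffunP => i; rewrite !ffunE; case: eqP => // ->.
  apply: leq_prod => i _; rewrite ffunE; case: ifPn => // /eqP ->.
  by rewrite eqxx leq_b1.
by move=> jo j'o mo; apply/eqP; rewrite eqn_leq !gen.
Qed.

Definition steps o y (i j : I) : nat := count_mem (i, j) (zip (o :: y) y).

Definition trails n k o r : {set n.-tuple I} :=
  [set y : n.-tuple I |
     [forall i, forall j, steps o y i j == k i j] && (last o y == r)].

Lemma card_trailsS n k o r :
  #|trails n.+1 k o r| =
  \sum_(j | 0 < k o j) #|trails n (decr k o j) j r|.
Proof.
rewrite -sum1_card.
pose F (y : n.+1.-tuple I) : nat := y \in trails n.+1 k o r.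
transitivity (\sum_y F y).
  by rewrite big_mkcond; apply: eq_bigr => y _; rewrite /F; case: ifP.
transitivity (\sum_(p : I * n.-tuple I) F (cons_tuple p.1 p.2)).
  rewrite (reindex (fun p : I * n.-tuple I => cons_tuple p.1 p.2))//.
  exists (fun y : n.+1.-tuple I => (thead y, [tuple of behead y])) => //.
    by move=> [a b] _; congr pair; apply: val_inj.
  by move=> y _; rewrite [RHS]tuple_eta; apply: val_inj.
rewrite -(pair_bigA _ (fun j (z : n.-tuple I) => F (cons_tuple j z)))/= [RHS]big_mkcond/=.
apply: eq_bigr => j _; rewrite -sum1_card.
case: ifPn => k0.
  rewrite [RHS]big_mkcond/=; apply: eq_bigr => y _; rewrite /F !inE/=.
  case: (last j y == r); rewrite ?andbT ?andbF//.
  suff -> : [forall a, forall b, steps o (j :: y) a b == k a b] =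
    [forall a, forall b, steps j y a b == decr k o j a b] by case: ifP.
  apply: eq_forallb => a; apply: eq_forallb => b.
  rewrite /steps /decr/= [(o, j) == _]eq_sym.
  have [[-> ->]|_] := eqVneq (a, b) (o, j); last by rewrite add0n subn0.
  by rewrite add1n -[in LHS](prednK k0) subn1.
apply: big1 => y _; rewrite /F !inE/=.
case: forallP => // /(_ o) /forallP/(_ j).
by rewrite /steps/= eqxx; move: k0; rewrite -eqn0Ngt => /eqP ->.
Qed.

(** The factorials make parallel arcs distinguishable: with n the total count, these are the
    Eulerian trails from [o] to [r] in the multigraph with [k i j] arcs from i to j. The first-step
    recursion then has coefficients [k o j], as in [sum_tree_weight_decr]. *)
Definition wtrails n k o r : nat :=
  #|trails n k o r| * \prod_i \prod_j (k i j)`!.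

Lemma wtrailsS n k o r :
  wtrails n.+1 k o r = \sum_j k o j * wtrails n (decr k o j) j r.
Proof.
rewrite /wtrails card_trailsS big_distrl/= big_mkcond/=.
apply: eq_bigr => j _; case: ifPn => [k0|]; last first.
  by rewrite -eqn0Ngt => /eqP ->; rewrite mul0n.
rewrite mulnCA; congr (_ * _).
rewrite !pair_bigA/= (bigD1 (o, j))//= [in RHS](bigD1 (o, j))//= mulnA.
congr (_ * _).
  rewrite /decr eqxx; case: (k o j) k0 => // a _; by rewrite subn1 factS.
by apply: eq_bigr => -[a b]/= /negPf ab; rewrite /decr ab subn0.
Qed.

(* Rows of exhausted vertices are redirected to the root, which makes those
   vertices harmless leaves. *)
Definition fill r k : I -> I -> nat :=
  fun i j => if row k i == 0 then (j == r : nat) else k i j.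

Lemma row_decr k o j i : 0 < k o j ->
  row (decr k o j) i = row k i - (i == o).
Proof.
move=> k0; rewrite /row; case: eqP => [->|io]; last first.
  rewrite subn0; apply: eq_bigr => b _.
  by rewrite /decr xpair_eqE; case: eqP io => //; rewrite subn0.
rewrite (bigD1 j)//= [in RHS](bigD1 j)//= /decr eqxx addnBAC//; congr (_ + _ - _).
by apply: eq_bigr => b bj; rewrite xpair_eqE (negPf bj) andbF subn0.
Qed.

Lemma col_decr k o j i : 0 < k o j ->
  col (decr k o j) i = col k i - (i == j).
Proof.
move=> k0; rewrite /col; case: eqP => [->|ij]; last first.
  rewrite subn0; apply: eq_bigr => b _.
  by rewrite /decr xpair_eqE; case: (i =P j) ij => //; rewrite andbF subn0.
rewrite (bigD1 o)//= [in RHS](bigD1 o)//= /decr eqxx addnBAC//; congr (_ + _ - _).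
by apply: eq_bigr => b bj; rewrite xpair_eqE (negPf bj) subn0.
Qed.

Lemma row_eq0 k i j : row k i = 0 -> k i j = 0.
Proof. by move/eqP; rewrite sum_nat_eq0 => /forallP/(_ j)/eqP. Qed.

Lemma col_eq0 k i j : col k i = 0 -> k j i = 0.
Proof. by move/eqP; rewrite sum_nat_eq0 => /forallP/(_ j)/eqP. Qed.

(** The divergence condition, with negative terms moved across so that it stays in [nat]. *)
Definition balanced k o r :=
  forall i, row k i + (i == r) = col k i + (i == o).

Lemma balanced_decr k o j r : 0 < k o j -> balanced k o r ->
  balanced (decr k o j) j r.
Proof.
move=> k0 b i; rewrite row_decr// col_decr//.
have := b i.
have : 0 < row k o by rewrite /row (bigD1 j)//= ltn_addr.
have : 0 < col k j by rewrite /col (bigD1 o)//= ltn_addr.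
by case: (i =P o) => [io|_]; case: (i =P j) => [ij|_];
  rewrite -?io -?ij; case: (i =P r) => _ /=; lia.
Qed.

(** The first step changes only row [o]. If [o] is the root, tree weights do not involve that row;
    if [o] keeps other steps, [sum_tree_weight_decr] applies; if this was its last step, [o] becomes
    a leaf that [fill] reattaches to the root. *)
Theorem wtrailsE n k o r : (forall i, k i i = 0) -> balanced k o r ->
  n = \sum_i row k i ->
  wtrails n k o r =
  tree_weight r (fill r k) * ((row k r)`! * \prod_(i | i != r) ((row k i).-1)`!).
Proof.
elim: n k o => [|n IH] k o kii kb.
  move/esym/eqP; rewrite sum_nat_eq0 => /forallP k0.
  have rk i : row k i = 0 by apply/eqP; exact: k0.
  have ck i : col k i = 0.
    by rewrite /col; apply: big1 => j _; exact: row_eq0.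
  have or : o = r.
    by have := kb r; rewrite rk ck eqxx; have [->|] := eqVneq r o.
  rewrite /wtrails (_ : #|_| = 1); last first.
    rewrite (_ : trails _ _ _ _ = [set [tuple]]) ?cards1//.
    apply/setP => y; rewrite !inE tuple0 /= or eqxx andbT; apply/forallP => i.
    by apply/forallP => j; rewrite /steps/= row_eq0.
  rewrite rk [X in 1 * X]big1 => [|i _]; last first.
    by rewrite big1// => j _; rewrite row_eq0.
  rewrite [X in _ = _ * (_ * X)]big1 => [|i _]; last by rewrite rk.
  (* All rows are filled, so the star with every vertex attached to [r] is the only tree of nonzero
     weight. *)
  rewrite !muln1 /tree_weight (bigD1 [ffun => r])//=; last first.
    rewrite /tree_map ffunE eqxx; apply/forallP => i.
    by apply: connect1; rewrite /= ffunE.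
  rewrite big1 => [|i _]; last by rewrite /fill rk eqxx ffunE eqxx.
  rewrite big1// => f /andP[/andP[/eqP fr _]] fN.
  have [i fi] : exists i, f i != r.
    apply/existsP; move: fN; apply: contraNT; rewrite negb_exists.
    move/forallP => H; apply/eqP/ffunP => i; rewrite ffunE.
    by have := H i; rewrite negbK => /eqP.
  have ir : i != r by apply: contraNneq fi => ->; rewrite fr.
  by rewrite (bigD1 i)//= /fill rk eqxx (negPf fi).
move=> nk; rewrite wtrailsS.
have nkj j : 0 < k o j -> n = \sum_i row (decr k o j) i.
  move=> k0; apply/eqP; rewrite -eqSS nk; apply/eqP.
  rewrite (bigD1 o)//= [in RHS](bigD1 o)//= row_decr// eqxx subn1 -addSn prednK.
    by congr addn; apply: eq_bigr => i io; rewrite row_decr// (negPf io) subn0.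
  by rewrite /row (bigD1 j)//= ltn_addr.
have IHj j : 0 < k o j -> wtrails n (decr k o j) j r =
  tree_weight r (fill r (decr k o j)) * ((row (decr k o j) r)`! *
    \prod_(i | i != r) ((row (decr k o j) i).-1)`!).
  move=> k0; apply: IH => //; [|exact: balanced_decr|exact: nkj].
  by move=> i; rewrite /decr kii sub0n.
have [or|or] := eqVneq o r.
  subst o; have [rr|rr] := eqVneq (row k r) 0.
    (* Steps remain but none leaves the start, so no trail exists. The trees vanish too: from a
       vertex with steps left, a tree of nonzero weight leads, by balance, only to vertices with
       steps left, hence never to [r]. *)
    rewrite big1 => [|j _]; last by rewrite row_eq0.
    have [i ri] : exists i, row k i != 0.
      apply/existsP; apply: contraPT nk; rewrite negb_exists => /forallP H.
      by rewrite big1// => i _; have := H i; rewrite negbK => /eqP.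
    rewrite [X in _ = X * _](_ : _ = 0)// /tree_weight big1// => f /andP[_ /forallP/(_ i) fi].
    apply/eqP; rewrite -[_ == 0]negbK -lt0n; apply/negP => fgt0.
    have fN a : a != r -> fill r k a (f a) != 0.
      by move=> ar; apply: contraTneq fgt0 => fa; rewrite (bigD1 a)//= fa.
    have cr : col k r = 0 by have := kb r; rewrite rr; lia.
    have key (p : nat) : row k (iter p f i) != 0.
      elim: p => [//|p] /=; set a := iter p f i => ra.
      have ar : a != r by apply: contraNneq ra => ->; rewrite rr.
      have := fN _ ar; rewrite /fill (negPf ra) => kfa.
      have far : f a != r by apply: contraNneq kfa => ->; rewrite col_eq0.
      have := kb (f a); rewrite (negPf far) !addn0 => ->.
      by apply: contraNneq kfa => /col_eq0->.
    by have /iter_findex fir := fi; have := key (findex f i r); rewrite fir rr.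
  transitivity (\sum_j k r j * (tree_weight r (fill r k) *
      ((row k r).-1`! * \prod_(i | i != r) ((row k i).-1)`!))).
    apply: eq_bigr => j _; have [->//|kj] := posnP (k r j).
    rewrite IHj// row_decr// eqxx subn1; congr (_ * (_ * (_ * _))).
      apply: eq_tree_weight => a b ar; rewrite /fill row_decr// (negPf ar) subn0.
      by rewrite /decr xpair_eqE (negPf ar) subn0.
    by apply: eq_bigr => a ar; rewrite row_decr// (negPf ar) subn0.
  rewrite -big_distrl/= mulnCA -/(row k r); congr (_ * _).
  by rewrite mulnA; case: (row k r) rr => // a _; rewrite factS.
have ro : row k o = (col k o).+1.
  by have := kb o; rewrite eqxx (negPf or) addn0 addn1.
have ro0 : row k o != 0 by rewrite ro.
(* There is a single step out of [o] and no way back. Once it is made, [fill] attaches [o] to [r]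
   instead of [j0]; since no arc enters [o], [tree_weight_leaf] shows that this changes nothing. *)
have [co|co] := eqVneq (col k o) 0.
  have [j0 kj0] : exists j, k o j != 0.
    apply/existsP; apply: contraNT ro0; rewrite negb_exists => /forallP H.
    by apply/eqP/big1 => j _; have := H j; rewrite negbK => /eqP.
  have kj j : k o j = (j == j0).
    have : row k o = 1 by rewrite ro co.
    rewrite /row (bigD1 j0)//=.
    have [->|jj0] := eqVneq j j0; first by lia.
    by rewrite (bigD1 j)//=; lia.
  rewrite (bigD1 j0)//= [X in _ + X]big1 ?addn0; last first.
    by move=> j /negPf jj; rewrite kj jj.
  have kj0' : 0 < k o j0 by rewrite kj eqxx.
  have j0o : j0 != o by apply: contraTneq kj0' => ->; rewrite kii.
  rewrite kj eqxx mul1n IHj// row_decr// [r == o]eq_sym (negPf or) subn0.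
  congr (_ * (_ * _)).
    pose m := fill r k.
    have := @tree_weight_leaf r o m j0 r or j0o; rewrite eq_sym => /(_ or).
    move=> /(_ _)/esym/= E.
    transitivity (tree_weight r (fun a b => if a == o then (b == r : nat) else m a b)).
      apply: eq_tree_weight => a b ar; rewrite /m /fill row_decr//.
      have [->|ao] := eqVneq a o; first by rewrite ro co.
      by rewrite subn0 /decr xpair_eqE (negPf ao) subn0.
    rewrite E; last first.
      move=> i ir; rewrite /m /fill (negPf or); case: ifP => // _.
      exact: col_eq0.
    apply: eq_tree_weight => a b ar; rewrite /m.
    have [->|//] := eqVneq a o; by rewrite /fill (negPf ro0) kj.
  apply: eq_bigr => i _; rewrite row_decr//; have [->|] := eqVneq i o.
    by rewrite ro co.
  by rewrite subn0.
(* A departure from [o] remains after the step, so [fill] and [decr] commute off the root's row, and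
   the sum over j yields the factor row - 1 that completes the factorial. *)
have ro2 : row k o - 1 != 0 by rewrite ro subn1.
transitivity (\sum_j fill r k o j * tree_weight r (decr (fill r k) o j) *
   ((row k r)`! * (((row k o).-2)`! *
    \prod_(i | (i != r) && (i != o)) ((row k i).-1)`!))).
  apply: eq_bigr => j _; rewrite {1}/fill (negPf ro0).
  have [->//|kj] := posnP (k o j).
  rewrite IHj// -mulnA; congr (_ * (_ * (_ * _))).
  - apply: eq_tree_weight => a b ar; rewrite /fill /decr row_decr//.
    have [->|ao] := eqVneq a o; first by rewrite (negPf ro0) (negPf ro2).
    by rewrite xpair_eqE (negPf ao) !subn0.
  - by rewrite row_decr// [r == o]eq_sym (negPf or) subn0.
  rewrite (bigD1 o)//= row_decr// eqxx subn1; congr (_ * _).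
  by apply: eq_bigr => i /andP[_ io]; rewrite row_decr// (negPf io) subn0.
rewrite -big_distrl/= sum_tree_weight_decr// [in RHS](bigD1 o)//=.
rewrite (_ : row (fill r k) o = row k o); last first.
  by apply: eq_bigr => j _; rewrite /fill (negPf ro0).
rewrite ro; case: (col k o) co => // a _; rewrite factS/=; lia.
Qed.

End best.

(** * Oriented spanning trees as parent maps *)

Lemma card_classical_set (I : finType) (p : pred I) :
  #|[set x | p x]%classic| = #|[set x | p x]%SET|.
Proof. by apply: eq_card => x; rewrite inE; apply/idP/idP; rewrite in_setE. Qed.

Section spanning_trees.
Variables (I : finType) (e : rel I) (r : I).
Implicit Types (f : {ffun I -> I}) (T : {set I * I}).

Definition arcs_of f : {set I * I} := [set (i, f i) | i in predC1 r].

Definition parent_of T : {ffun I -> I} :=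
  [ffun i => if i == r then r else odflt r [pick j | (i, j) \in T]].

Lemma mem_arcs_of f i j : ((i, j) \in arcs_of f) = (i != r) && (j == f i).
Proof.
apply/imsetP/andP => [[a ar [-> ->]]|[ir /eqP ->]]; last by exists i.
by rewrite eqxx; split.
Qed.

Lemma arcs_of_parent T : (forall i, #|[set j | (i, j) \in T]| = (i != r) :> nat) ->
  arcs_of (parent_of T) = T.
Proof.
move=> degT; apply/setP => -[i j]; rewrite mem_arcs_of ffunE.
have := degT i; case: eqVneq => [->|ir] /=.
  by move=> /eqP; rewrite cards_eq0 => /eqP/setP/(_ j); rewrite !inE => ->.
move=> /eqP/cards1P[b /setP bE]; case: pickP => [c /= cT|H].
  have := bE c; rewrite !inE cT => /esym/eqP ->.
  by have := bE j; rewrite !inE.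
by have := bE b; rewrite !inE eqxx H.
Qed.

Lemma parent_arcs_of f : f r = r -> parent_of (arcs_of f) = f.
Proof.
move=> fr; apply/ffunP => i; rewrite ffunE; case: eqVneq => [->//|ir].
case: pickP => [j|/(_ (f i))]; rewrite mem_arcs_of ir ?eqxx//=.
by move=> /eqP.
Qed.

(** The vertices whose orbit reaches [r] form a set that no arc enters or leaves; it contains [r],
    hence everything by connectedness. *)
Lemma connected_tree_map f : f r = r ->
  (forall i j, connect [rel i j | ((i, j) \in arcs_of f) ||
     ((j, i) \in arcs_of f)] i j) -> tree_map r f.
Proof.
move=> fr conn; rewrite /tree_map fr eqxx; apply/forallP => i.
pose C := [pred i | fconnect f i r].
have : fingraph.closed [rel i j | ((i, j) \in arcs_of f) || ((j, i) \in arcs_of f)] C.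
  suff H x : fconnect f x r = fconnect f (f x) r.
    move=> x z /=; rewrite !mem_arcs_of !inE.
    by move=> /orP[/andP[_ /eqP ->]|/andP[_ /eqP ->]]; rewrite -H.
  apply/idP/idP => [|H]; last by apply: connect_trans H; exact: fconnect1.
  move=> /iter_findex; case: (findex f x r) => [/= ->|n].
    by rewrite fr connect0.
  by rewrite iterSr => <-; exact: fconnect_iter.
move=> /closed_connect/(_ _ _ (conn r i)).
by rewrite !inE connect0.
Qed.

Lemma connect_arcs_of f : tree_map r f ->
  forall i j, connect [rel i j | ((i, j) \in arcs_of f) ||
     ((j, i) \in arcs_of f)] i j.
Proof.
move=> /andP[/eqP fr /forallP fc]; set u := [rel i j | _].
have us : connect_sym u by apply: sym_connect_sym => a b /=; rewrite orbC.
have H i : connect u i r.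
  have /iter_findex := fc i; move: (findex f i r) => n.
  elim: n i => [i /= ->|n IH i]; first exact: connect0.
  rewrite iterSr => /IH; apply: connect_trans.
  have [->|ir] := eqVneq i r; first by rewrite fr connect0.
  by apply: connect1; rewrite /= mem_arcs_of ir eqxx.
by move=> i j; apply: connect_trans (H i) _; rewrite us.
Qed.

(* The two neighbours on a cycle of a vertex of maximal depth are both its
   parent. *)
Lemma ucycle_arcs_of f : tree_map r f ->
  forall c : seq I, ucycle [rel i j | ((i, j) \in arcs_of f) ||
     ((j, i) \in arcs_of f)] c -> (size c <= 2)%N.
Proof.
move=> /andP[/eqP fr /forallP fc] c /andP[cc uc]; rewrite leqNgt; apply/negP => c3.
have reach i : exists n, iter n f i == r.
  by exists (findex f i r); rewrite iter_findex.
pose d i := ex_minn (reach i).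
have dS i : i != r -> d i = (d (f i)).+1.
  move=> ir; rewrite /d; case: ex_minnP => -[|n]; first by rewrite /= (negPf ir).
  rewrite iterSr => ni min_n; case: ex_minnP => m mi min_m.
  by apply/eqP; rewrite eqn_leq min_n ?iterSr// ltnS min_m.
have [x0 x0c] : exists x0, x0 \in c by case: c c3 {cc uc} => // a ? _; exists a; rewrite mem_head.
pose x := [arg max_(x > x0 in c) d x].
have [xc xmax] : x \in c /\ forall y, y \in c -> (d y <= d x)%N.
  by rewrite /x; case: arg_maxnP.
have [n s cs] := rot_to xc.
have xparent y : y \in c -> ((x, y) \in arcs_of f) || ((y, x) \in arcs_of f) -> y = f x.
  move=> yc; rewrite !mem_arcs_of => /orP[/andP[_ /eqP//]|/andP[yr /eqP xy]].
  by have := xmax _ yc; rewrite (dS _ yr) -xy ltnn.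
move: cc uc c3; rewrite -(rot_cycle n) -(rot_uniq n) -(size_rot n) cs.
have sc y : y \in s -> y \in c by move=> ys; rewrite -(mem_rot n) cs inE ys orbT.
case/lastP: s sc {cs} => [//|s z] sc /=; rewrite rcons_path last_rcons => /andP[p1 zx].
have zE : z = f x by apply: xparent; [rewrite sc// mem_rcons mem_head|rewrite orbC].
case: s sc p1 => [//|y s] sc /= /andP[xy _].
have yE : y = f x by apply: xparent => //; rewrite sc// mem_head.
by rewrite mem_rcons zE -yE inE eqxx/= andbF.
Qed.

Lemma oriented_spanning_treeP f : f r = r ->
  oriented_spanning_tree e r (arcs_of f) <->
  tree_map r f /\ forall i, i != r -> e i (f i).
Proof.
move=> fr; split=> [[Te conn _ _]|[tf ef]].
  split; first exact: connected_tree_map.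
  by move=> i ir; apply: Te; rewrite mem_arcs_of ir eqxx.
split.
- by move=> i j; rewrite mem_arcs_of => /andP[ir /eqP ->]; exact: ef.
- exact: connect_arcs_of.
- exact: ucycle_arcs_of.
- move=> i; rewrite card_classical_set; case: eqVneq => [->|ir].
    by apply/eqP; rewrite /= cards_eq0; apply/eqP/setP => j; rewrite !inE mem_arcs_of eqxx.
  apply/eqP/cards1P; exists (f i); apply/setP => j.
  by rewrite !inE mem_arcs_of ir.
Qed.

Lemma sum_oriented_spanning_trees (k : I -> I -> nat) :
  (forall i j, ~~ e i j -> k i j = 0%N) ->
  (\sum_(T : {set I * I} | `[< oriented_spanning_tree e r T >])
    \prod_(a in T) k a.1 a.2 = tree_weight r k)%N.
Proof.
move=> k0.
rewrite (reindex_onto arcs_of parent_of) => [|T /asboolP[_ _ _ degT]]; last first.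
  by apply: arcs_of_parent => i; rewrite -card_classical_set.
rewrite /tree_weight big_mkcond [RHS]big_mkcond; apply: eq_bigr => f _.
have prodE : (\prod_(a in arcs_of f) k a.1 a.2 = \prod_(i | i != r) k i (f i))%N.
  by rewrite big_imset//= => i j _ _ [].
have [fr|fr] := eqVneq (f r) r; last first.
  (* Every [parent_of T] fixes [r], so this [f] is reached by no set of arcs; nor is it a tree
     map. *)
  rewrite ifF; first by rewrite /tree_map (negPf fr).
  apply/negbTE; rewrite negb_and; apply/orP; right; apply: contraNN fr => /eqP <-.
  by rewrite ffunE eqxx.
rewrite parent_arcs_of// eqxx andbT; case: ifPn => [/asboolP/oriented_spanning_treeP[//|-> _]|].
  by rewrite prodE.
(* The arcs of a tree map fail to be a spanning tree of [e] only through an arc outside [e], where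
   [k] vanishes. *)
case: ifPn => // tf /asboolP nT; apply/esym/eqP; apply: contra_notT nT => nz.
apply/oriented_spanning_treeP => //; split => // i ir.
apply: contraNT nz => /k0 ki.
by rewrite (bigD1 i)//= ki.
Qed.

End spanning_trees.

Local Open Scope classical_set_scope.
Local Open Scope ring_scope.

(** * Integration over the simplex *)

Section power_convolution.
Context {R : realType}.
Local Notation mu := (@lebesgue_measure R).

Lemma integral_lebesgue_shift (f : R -> \bar R) (a : R) :
  measurable_fun setT f -> (forall x, 0 <= f x)%E ->
  (\int[mu]_x f (x + a)%R = \int[mu]_x f x)%E.
Proof.
move=> mf f0.
have ma : measurable_fun setT (fun x : measurableTypeR R => (x + a : measurableTypeR R)).
  exact: measurable_funD.
rewrite -[RHS](@eq_measure_integral _ _ _ _ _ (image_measure mu ma)); last first.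
  move=> A mA _; apply/esym/lebesgue_measure_unique => //= _ [[x y]] _ <-.
  rewrite /pushforward.
  rewrite (_ : _ @^-1` _ = `]x - a, y - a]%classic); last first.
    by apply/seteqP; split => z /=; rewrite !in_itv/= ltrBlDr lerBrDr.
  rewrite !lebesgue_measure_itv/= !lte_fin ltrD2r; congr (if _ then _ else _).
  by congr EFin; ring.
by rewrite ge0_integral_pushforward.
Qed.

(** Up to the factor exp(-u), the density of a sum of [a.+1] independent exponential times of
    parameter 1; [gpow 0] is the indicator of the positive reals. *)
Definition gpow (a : nat) (u : R) : R := if 0 < u then u ^+ a / a`!%:R else 0.

Lemma gpow_ge0 a u : 0 <= gpow a u.
Proof. by rewrite /gpow; case: ifPn => // /ltW u0; rewrite divr_ge0// exprn_ge0. Qed.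

Lemma measurable_gpow a : measurable_fun setT (gpow a).
Proof.
rewrite /gpow; apply: measurable_fun_ifT => //.
  exact: measurable_fun_ltr.
by apply: measurable_funM => //; exact: measurable_funX.
Qed.

Lemma integral_pow (a : nat) (t : R) : 0 <= t ->
  (\int[mu]_(u in `[0%R, t]) (u ^+ a / a`!%:R)%:E = (t ^+ a.+1 / a.+1`!%:R)%:E)%E.
Proof.
rewrite le_eqVlt => /predU1P[<-|t0].
  by rewrite set_itv1 integral_set1 expr0n mul0r.
have ct m : continuous (fun u : R => u ^+ m / m`!%:R).
  by move=> z; apply: cvgM; [exact: exprn_continuous|exact: cvg_cst].
have dt (x : R) : derivable (fun u : R => u ^+ a.+1) x 1 by exact: exprn_derivable.
rewrite (@continuous_FTC2 _ _ (fun u => u ^+ a.+1 / a.+1`!%:R))//.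
- by rewrite expr0n mul0r sube0.
- exact: continuous_subspaceT.
- split.
  + by move=> z _; apply: derivableM.
  + apply: cvg_at_right_filter; exact: ct.
  + apply: cvg_at_left_filter; exact: ct.
- move=> z _; rewrite derive1Mr// exp_derive1 factS natrM -[_ *: _]/(_ * _) /=.
  by field; rewrite nat1r !pnatr_eq0 -lt0n fact_gt0.
Qed.

Lemma integral_lebesgueN (f : R -> \bar R) :
  measurable_fun setT f -> (forall x, 0 <= f x)%E ->
  (\int[mu]_x f (- x)%R = \int[mu]_x f x)%E.
Proof.
move=> mf f0.
have mN : measurable_fun setT (-%R : measurableTypeR R -> measurableTypeR R).
  exact: measurable_funN.
rewrite -[RHS](@eq_measure_integral _ _ _ _ _ (image_measure mu mN)); last first.
  by move=> A mA _; exact: lebesgue_measureN.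
by rewrite ge0_integral_pushforward.
Qed.

(* Unlike gpow, hpow 0 is 1 at 0: the last holding time may have elapsed for a
   zero duration at time t. *)
Definition hpow (a : nat) (u : R) : R := if 0 <= u then u ^+ a / a`!%:R else 0.

Lemma hpow_ge0 a u : 0 <= hpow a u.
Proof. by rewrite /hpow; case: ifPn => // u0; rewrite divr_ge0// exprn_ge0. Qed.

Lemma measurable_hpow a : measurable_fun setT (hpow a).
Proof.
rewrite /hpow; apply: measurable_fun_ifT => //.
  exact: measurable_fun_ler.
by apply: measurable_funM => //; exact: measurable_funX.
Qed.

Lemma gpow_convolution a s :
  (\int[mu]_u (gpow a u * gpow 0 (s - u))%:E = (gpow a.+1 s)%:E)%E.
Proof.
rewrite {3}/gpow; case: ifPn => [s0|]; last first.
  rewrite -leNgt => s0; apply: integral0_eq => u _.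
  rewrite /gpow; case: ltP; rewrite ?mul0r// subr_gt0 => u0.
  by rewrite ltNge (le_trans s0 (ltW u0)) mulr0.
rewrite -integral_pow ?ltW// [RHS](@integral_itv_bndoo _ _ _ _ true false); last first.
  apply/measurable_EFinP; apply: measurable_funM => //; exact: measurable_funX.
rewrite [RHS]integral_mkcond; apply: eq_integral => u _.
rewrite patchE mem_setE in_itv/= /gpow subr_gt0 expr0 fact0 divr1.
by case: (0 < u); case: (u < s); rewrite /= ?mul0r ?mulr1 ?mulr0.
Qed.

Lemma convolutionC (f g : R -> R) s :
  measurable_fun setT f -> measurable_fun setT g ->
  (forall x, 0 <= f x) -> (forall x, 0 <= g x) ->
  (\int[mu]_u (f u * g (s - u))%:E = \int[mu]_u (g u * f (s - u))%:E)%E.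
Proof.
move=> mf mg f0 g0.
pose k u := (f u * g (s - u))%:E.
have mk : measurable_fun setT k.
  apply/measurable_EFinP; apply: measurable_funM => //.
  by apply: measurableT_comp mg _; exact: measurable_funB.
rewrite -(@integral_lebesgue_shift k s)//; last first.
  by move=> x; rewrite lee_fin mulr_ge0.
rewrite -integral_lebesgueN//; last 2 first.
- apply: measurableT_comp mk _; exact: measurable_funD.
- by move=> x; rewrite lee_fin mulr_ge0.
by apply: eq_integral => u _; rewrite /k mulrC; congr (g _ * f _)%:E; ring.
Qed.

Lemma gpow_convolutionC a s :
  (\int[mu]_u (gpow 0 u * gpow a (s - u))%:E = (gpow a.+1 s)%:E)%E.
Proof.
by rewrite convolutionC ?gpow_convolution//;
  do ?[exact: measurable_gpow|exact: gpow_ge0].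
Qed.

Lemma hpow_convolution a s :
  (\int[mu]_u (gpow 0 u * hpow a (s - u))%:E = (hpow a.+1 s)%:E)%E.
Proof.
transitivity (\int[mu]_u (hpow a u * gpow 0 (s - u))%:E)%E.
  by apply: convolutionC; do ?[exact: measurable_gpow|exact: measurable_hpow|
    exact: gpow_ge0|exact: hpow_ge0].
rewrite {2}/hpow; case: ifPn => [s0|]; last first.
  rewrite -ltNge => s0; apply: integral0_eq => u _.
  rewrite /gpow /hpow subr_gt0; have [u0|] := leP 0 u; rewrite ?mul0r//.
  by rewrite ltNge (le_trans (ltW s0) u0) mulr0.
(* The endpoint s, where [gpow 0 (s - u)] vanishes, is a null set. *)
rewrite -integral_pow// -integral_itv_bndo_bndc; last first.
  by apply/measurable_EFinP; apply: measurable_funM => //; exact: measurable_funX.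
rewrite [RHS]integral_mkcond; apply: eq_integral => u _.
rewrite patchE mem_setE in_itv/= /hpow /gpow subr_gt0 expr0 fact0 divr1.
by case: (0 <= u); case: (u < s); rewrite /= ?mul0r ?mulr1 ?mulr0.
Qed.

End power_convolution.

(** * Integrating over the durations of visits to one coordinate *)

Section coordinate_integrals.
Context {R : realType}.
Local Notation mu := (@lebesgue_measure R).
Local Open Scope ereal_scope.

Definition addcoord n (x : n.-tuple R) (i : 'I_n) (u : R) : n.-tuple R :=
  [tuple (tnth x j + (j == i)%:R * u)%R | j < n].

Lemma measurable_addcoord d (T : measurableType d) n (i : 'I_n)
    (f : T -> n.-tuple R) (u : T -> R) :
  measurable_fun setT f -> measurable_fun setT u ->
  measurable_fun setT (fun z => addcoord (f z) i (u z)).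
Proof.
move=> mf mu'; apply/measurable_fun_tnthP => j.
rewrite (_ : _ \o _ = fun z => (tnth (f z) j + (j == i)%:R * u z)%R); last first.
  by apply/funext => z /=; rewrite tnth_mktuple.
apply: measurable_funD; last exact: measurable_funM.
exact: (measurableT_comp (measurable_tnth j) mf).
Qed.

Lemma addcoordC n (x : n.-tuple R) i j u v :
  addcoord (addcoord x i u) j v = addcoord (addcoord x j v) i u.
Proof. by apply: eq_from_tnth => k; rewrite !tnth_mktuple addrAC. Qed.

Lemma addcoordD n (x : n.-tuple R) i u v :
  addcoord (addcoord x i u) i v = addcoord x i (u + v).
Proof. by apply: eq_from_tnth => k; rewrite !tnth_mktuple mulrDr addrA. Qed.

Lemma sum_addcoord n (x : n.-tuple R) i u :
  (\sum_j tnth (addcoord x i u) j = \sum_j tnth x j + u)%R.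
Proof.
under eq_bigr do rewrite tnth_mktuple.
rewrite big_split/=; congr (_ + _)%R; rewrite (bigD1 i)//= eqxx mul1r big1 ?addr0//.
by move=> j /negPf ->; rewrite mul0r.
Qed.

(* By gpow_convolution, Jop a i is the (a+1)-fold iterate of Jop 0 i: it adds to
   coordinate i the total duration of a+1 visits. *)
Definition Jop n a (i : 'I_n) (g : n.-tuple R -> \bar R) (x : n.-tuple R) : \bar R :=
  \int[mu]_u ((gpow a u)%:E * g (addcoord x i u)).

Section Jop.
Variables (n : nat).
Implicit Types (g : n.-tuple R -> \bar R) (i j : 'I_n).

Lemma measurable_Jop_integrand d (T : measurableType d) a i g (f : T -> n.-tuple R) (u : T -> R) :
  measurable_fun setT g -> measurable_fun setT f -> measurable_fun setT u ->
  measurable_fun setT (fun z => (gpow a (u z))%:E * g (addcoord (f z) i (u z))).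
Proof.
move=> mg mf mu'; apply: emeasurable_funM.
  by apply/measurable_EFinP; apply: measurableT_comp mu'; exact: measurable_gpow.
by apply: measurableT_comp mg _; exact: measurable_addcoord.
Qed.

Lemma Jop_ge0 a i g x : (forall x, 0 <= g x) -> 0 <= Jop a i g x.
Proof.
by move=> g0; apply: integral_ge0 => u _; rewrite mule_ge0// lee_fin gpow_ge0.
Qed.

Lemma measurable_Jop a i g : measurable_fun setT g -> (forall x, 0 <= g x) ->
  measurable_fun setT (Jop a i g).
Proof.
move=> mg g0.
pose f (z : n.-tuple R * measurableTypeR R) := (gpow a z.2)%:E * g (addcoord z.1 i z.2).
rewrite (_ : Jop a i g = fubini_F mu f)//; apply: measurable_fun_fubini_tonelli_F.
  exact: measurable_Jop_integrand.
by move=> z; rewrite /f mule_ge0// lee_fin gpow_ge0.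
Qed.

Lemma JopC a b i j g x : measurable_fun setT g -> (forall x, 0 <= g x) ->
  Jop a i (Jop b j g) x = Jop b j (Jop a i g) x.
Proof.
move=> mg g0.
pose f (z : measurableTypeR R * measurableTypeR R) :=
  (gpow a z.1)%:E * ((gpow b z.2)%:E * g (addcoord (addcoord x i z.1) j z.2)).
have mf : measurable_fun setT f.
  apply: emeasurable_funM.
    by apply/measurable_EFinP; apply: measurableT_comp => //; exact: measurable_gpow.
  apply: measurable_Jop_integrand => //; exact: measurable_addcoord.
have f0 z : 0 <= f z by rewrite /f !mule_ge0// lee_fin gpow_ge0.
transitivity (\int[mu]_u \int[mu]_v f (u, v)).
  apply: eq_integral => u _; rewrite -ge0_integralZl_EFin ?gpow_ge0//.
  - by move=> v _; rewrite mule_ge0// lee_fin gpow_ge0.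
  - exact: measurable_Jop_integrand.
rewrite fubini_tonelli//.
apply: eq_integral => v _; rewrite -ge0_integralZl_EFin ?gpow_ge0//.
- by apply: eq_integral => u _; rewrite /f /= muleCA addcoordC.
- by move=> u _; rewrite mule_ge0// lee_fin gpow_ge0.
- exact: measurable_Jop_integrand.
Qed.

(** Tonelli after the shift of v by u: v becomes the total duration added to coordinate [i], and
    integrating out u convolves the two weights. *)
Lemma Jop_succ a i g x : measurable_fun setT g -> (forall x, 0 <= g x) ->
  Jop 0 i (Jop a i g) x = Jop a.+1 i g x.
Proof.
move=> mg g0; rewrite JopC//.
have ms (c : R) : measurable_fun setT (fun u : R => c - u)%R by exact: measurable_funB.
pose f (z : measurableTypeR R * measurableTypeR R) :=
  (gpow a z.1)%:E * ((gpow 0 (z.2 - z.1))%:E * g (addcoord x i z.2)).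
have mf : measurable_fun setT f.
  apply: emeasurable_funM.
    by apply/measurable_EFinP; apply: measurableT_comp => //; exact: measurable_gpow.
  apply: emeasurable_funM.
    apply/measurable_EFinP; apply: measurableT_comp; first exact: measurable_gpow.
    exact: measurable_funB.
  by apply: measurableT_comp mg _; exact: measurable_addcoord.
have f0 z : 0 <= f z by rewrite /f !mule_ge0// lee_fin gpow_ge0.
transitivity (\int[mu]_u \int[mu]_v f (u, v)).
  apply: eq_integral => u _; rewrite /f/= ge0_integralZl_EFin ?gpow_ge0//; last 2 first.
  - by move=> v _; rewrite mule_ge0// lee_fin gpow_ge0.
  - apply: emeasurable_funM.
      apply/measurable_EFinP; apply: measurableT_comp; first exact: measurable_gpow.
      exact: measurable_funB.
    by apply: measurableT_comp mg _; exact: measurable_addcoord.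
  congr (_ * _); rewrite -[RHS](@integral_lebesgue_shift _ _ u).
  - by apply: eq_integral => v _; rewrite addrK addcoordD addrC.
  - apply: emeasurable_funM.
      apply/measurable_EFinP; apply: measurableT_comp; first exact: measurable_gpow.
      exact: measurable_funB.
    by apply: measurableT_comp mg _; exact: measurable_addcoord.
  - by move=> v; rewrite mule_ge0// lee_fin gpow_ge0.
rewrite fubini_tonelli//; apply: eq_integral => v _.
rewrite -gpow_convolution muleC -ge0_integralZl//=.
- by apply: eq_integral => u _; rewrite /f/= EFinM muleA muleC.
- apply/measurable_EFinP; apply: measurable_funM; first exact: measurable_gpow.
  by apply: measurableT_comp; [exact: measurable_gpow|exact: ms].
- by move=> u _; rewrite lee_fin mulr_ge0 ?gpow_ge0.
Qed.

End Jop.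
End coordinate_integrals.

(** * Sequences of visits *)

Section iterated_coordinate_integrals.
Context {R : realType}.
Local Notation mu := (@lebesgue_measure R).
Local Open Scope ereal_scope.
Variable n : nat.
Implicit Types (g : n.-tuple R -> \bar R) (i j : 'I_n) (s : seq 'I_n) (a : 'I_n -> nat).

Definition Jops a s g := foldr (fun i => Jop (a i) i) g s.

Lemma Jops_ge0 a s g x : (forall x, 0 <= g x) -> 0 <= Jops a s g x.
Proof. by move=> g0; elim: s x => //= i s IH x; exact: Jop_ge0. Qed.

Lemma measurable_Jops a s g : measurable_fun setT g -> (forall x, 0 <= g x) ->
  measurable_fun setT (Jops a s g).
Proof.
move=> mg g0; elim: s => //= i s IH; apply: measurable_Jop => // x.
exact: Jops_ge0.
Qed.

Lemma Jops_cat a s1 s2 g : Jops a (s1 ++ s2) g = Jops a s1 (Jops a s2 g).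
Proof. by rewrite /Jops foldr_cat. Qed.

(** Here the order of the visits is lost: the law of the occupation vector depends on the list only
    through its multiplicities. *)
Lemma Jops_perm a s1 s2 g : measurable_fun setT g -> (forall x, 0 <= g x) ->
  perm_eq s1 s2 -> Jops a s1 g = Jops a s2 g.
Proof.
move=> mg g0.
have swap i s h : measurable_fun setT h -> (forall x, 0 <= h x) ->
    Jop (a i) i (Jops a s h) = Jops a s (Jop (a i) i h).
  move=> mh h0; elim: s => //= j s <-; apply/funext => x; apply: JopC.
    exact: measurable_Jops.
  by move=> ?; exact: Jops_ge0.
elim: s1 s2 => [|i s1 IH] s2 p12.
  by move: p12; rewrite perm_sym => /perm_nilP ->.
have : i \in s2 by rewrite -(perm_mem p12) mem_head.
move=> /splitPr => s2E; case: s2E p12 => p q p12.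
rewrite /= (IH (p ++ q)); last first.
  by rewrite -(perm_cons i) (permPl p12) perm_catC /= perm_cons perm_catC.
rewrite !Jops_cat/= swap//; [exact: measurable_Jops|].
by move=> ?; exact: Jops_ge0.
Qed.

Lemma Jops0_nseq c i g : measurable_fun setT g -> (forall x, 0 <= g x) ->
  Jops (fun=> 0%N) (nseq c.+1 i) g = Jop c i g.
Proof.
move=> mg g0; elim: c => //= c ->; apply/funext => x; exact: Jop_succ.
Qed.

Lemma Jops0_flatten (c : 'I_n -> nat) s g :
  measurable_fun setT g -> (forall x, 0 <= g x) ->
  {in s, forall i, (0 < c i)%N} ->
  Jops (fun=> 0%N) (flatten [seq nseq (c i) i | i <- s]) g =
  Jops (fun i => (c i).-1) s g.
Proof.
move=> mg g0; elim: s => //= i s IH c0; rewrite Jops_cat -IH; last first.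
  by move=> j js; apply: c0; rewrite inE js orbT.
rewrite -Jops0_nseq.
- by rewrite prednK// c0// mem_head.
- exact: measurable_Jops.
- by move=> ?; exact: Jops_ge0.
Qed.

Fixpoint addcoords s (x : n.-tuple R) (v : seq R) : n.-tuple R :=
  match s, v with
  | i :: s', u :: v' => addcoords s' (addcoord x i u) v'
  | _, _ => x
  end.

Fixpoint gpows a s (v : seq R) : R :=
  match s, v with
  | i :: s', u :: v' => (gpow (a i) u * gpows a s' v')%R
  | _, _ => 1%R
  end.

Lemma gpows_ge0 a s v : (0 <= gpows a s v)%R.
Proof.
elim: s v => [|i s IH] [|u v]//=; by rewrite mulr_ge0 ?gpow_ge0.
Qed.

Lemma measurable_addcoords d (T : measurableType d) s m
    (f : T -> n.-tuple R) (v : T -> m.-tuple R) :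
  measurable_fun setT f -> measurable_fun setT v ->
  measurable_fun setT (fun z => addcoords s (f z) (v z)).
Proof.
elim: s m f v => [|i s IH] m f v mf mv.
  by rewrite (_ : (fun _ => _) = f)//; apply/funext => z; case: (tval (v z)).
case: m v mv => [|m] v mv.
  by rewrite (_ : (fun _ => _) = f)//; apply/funext => z; rewrite tuple0.
rewrite (_ : (fun _ => _) = fun z =>
    addcoords s (addcoord (f z) i (thead (v z))) [tuple of behead (v z)]); last first.
  by apply/funext => z; rewrite [in LHS](tuple_eta (v z)).
apply: IH.
- apply: measurable_addcoord => //.
  exact: (measurableT_comp (measurable_tnth ord0) mv).
- exact: (measurableT_comp (@measurable_behead _ _ _) mv).
Qed.

Lemma measurable_gpows d (T : measurableType d) a s m (v : T -> m.-tuple R) :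
  measurable_fun setT v ->
  measurable_fun setT (fun z => gpows a s (v z)).
Proof.
elim: s m v => [|i s IH] m v mv.
  by rewrite (_ : (fun _ => _) = cst 1%R)//; apply/funext => z; case: (tval (v z)).
case: m v mv => [|m] v mv.
  by rewrite (_ : (fun _ => _) = cst 1%R)//; apply/funext => z; rewrite tuple0.
rewrite (_ : (fun _ => _) = fun z =>
    gpow (a i) (thead (v z)) * gpows a s [tuple of behead (v z)])%R; last first.
  by apply/funext => z; rewrite [in LHS](tuple_eta (v z)).
apply: measurable_funM.
  apply: measurableT_comp; first exact: measurable_gpow.
  exact: (measurableT_comp (measurable_tnth ord0) mv).
apply: IH; exact: (measurableT_comp (@measurable_behead _ _ _) mv).
Qed.

Lemma integral_lebesgue_tuple_cons m (f : m.+1.-tuple R -> \bar R) :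
  measurable_fun setT f -> (forall x, 0 <= f x) ->
  \int[lebesgue_tuple R m.+1]_x f x =
  \int[mu]_u \int[lebesgue_tuple R m]_v f [tuple of u :: v].
Proof.
move=> mf f0.
transitivity (\int[image_measure (mu \x lebesgue_tuple R m)
   (@measurable_tcons R m)]_x f x); first exact: eq_measure_integral.
rewrite ge0_integral_pushforward//; last exact: measurable_tcons.
rewrite [_ @^-1` _]preimage_setT fubini_tonelli1//.
  by apply: measurableT_comp mf _; exact: measurable_tcons.
by move=> x; exact: f0.
Qed.

(** Turns the iterated integrals into one integral over the vector [v] of all durations, the form in
    which the parametrisation of the simplex can be recognised. *)
Lemma Jops_lebesgue_tuple a s g x : measurable_fun setT g -> (forall x, 0 <= g x) ->
  Jops a s g x = \int[lebesgue_tuple R (size s)]_v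
     ((gpows a s v)%:E * g (addcoords s x v)).
Proof.
move=> mg g0; elim: s x => [|i s IH] x.
  rewrite [RHS]/= integral_dirac//= ?mul1e ?diracT ?mul1e//.
rewrite [RHS](@integral_lebesgue_tuple_cons (size s)); last 2 first.
- apply: emeasurable_funM.
    by apply/measurable_EFinP; exact: (@measurable_gpows _ _ _ (i :: s)).
  apply: measurableT_comp mg _.
  exact: (@measurable_addcoords _ _ (i :: s)).
- by move=> v; rewrite mule_ge0// lee_fin gpows_ge0.
rewrite -[LHS]/(Jop (a i) i (Jops a s g) x).
apply: eq_integral => u _; rewrite IH -ge0_integralZl_EFin ?gpow_ge0//.
- by apply: eq_integral => v _ /=; rewrite EFinM muleA.
- by move=> v _; rewrite mule_ge0// lee_fin gpows_ge0.
- apply: emeasurable_funM.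
    by apply/measurable_EFinP; exact: measurable_gpows.
  by apply: measurableT_comp mg _; exact: measurable_addcoords.
Qed.

End iterated_coordinate_integrals.

(** * From visits to the simplex measure *)

Section simplex_integral.
Context {R : realType}.
Local Notation mu := (@lebesgue_measure R).
Local Open Scope ereal_scope.

Lemma tnth_addcoords n (s : seq 'I_n) (x : n.-tuple R) v k :
  (tnth (addcoords s x v) k =
   tnth x k + \sum_(p <- zip s v) (k == p.1)%:R * p.2)%R.
Proof.
elim: s x v => [|i s IH] x [|u v] /=; rewrite ?big_nil ?addr0//.
by rewrite IH tnth_mktuple big_cons addrA.
Qed.

Lemma gpowsE n a (s : seq 'I_n) (v : seq R) :
  (gpows a s v = \prod_(p <- zip s v) gpow (a p.1) p.2)%R.
Proof.
by elim: s v => [|i s IH] [|u v] /=; rewrite ?big_nil// big_cons IH.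
Qed.

Lemma zip_map_enum (I : Type) m (f : 'I_m -> I) (v : m.-tuple R) :
  zip [seq f j | j <- enum 'I_m] v = [seq (f j, tnth v j) | j <- enum 'I_m].
Proof.
have {1}-> : tval v = [seq tnth v j | j <- enum 'I_m] by rewrite map_tnth_enum.
by elim: (enum 'I_m) => //= j s ->.
Qed.

Variables (n : nat) (h : 'I_n) (t : R) (B : set (n.-tuple R)) (w : nat -> R -> R).
Hypothesis w_ge0 : forall a u, (0 <= w a u)%R.
Hypothesis mw : forall a, measurable_fun setT (w a).
Hypothesis w_convolution : forall a s,
  \int[mu]_u (gpow 0 u * w a (s - u))%:E = (w a.+1 s)%:E.
Hypothesis w_gt0 : forall a u, (0 < u)%R -> w a u = (u ^+ a / a`!%:R)%R.
Hypothesis mB : measurable B.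
Hypothesis Bpos : B `<=` positive_orthant R n.

Definition total_time (x : n.-tuple R) : R := (\sum_j tnth x j)%R.

Definition top_up (x : n.-tuple R) := addcoord x h (t - total_time x).

(** The time left is given to coordinate [h]. The weight [w] is abstract because it is [hpow] for
    the walk, whose current hold may have just begun at time t, and [gpow] for the Dirichlet
    integral. *)
Definition final_hold a (x : n.-tuple R) : \bar R :=
  (w a (t - total_time x) * \1_B (top_up x))%:E.

Lemma measurable_total_time : measurable_fun setT total_time.
Proof. by apply: measurable_sum => j; exact: measurable_tnth. Qed.

Lemma measurable_top_up : measurable_fun setT top_up.
Proof.
apply: measurable_addcoord => //; apply: measurable_funB => //.
exact: measurable_total_time.
Qed.

Lemma final_hold_ge0 a x : 0 <= final_hold a x.
Proof. by rewrite lee_fin mulr_ge0// w_ge0. Qed.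

Lemma measurable_final_hold a : measurable_fun setT (final_hold a).
Proof.
apply/measurable_EFinP; apply: measurable_funM.
  apply: measurableT_comp; first exact: mw.
  by apply: measurable_funB => //; exact: measurable_total_time.
apply: (measurableT_comp _ measurable_top_up).
exact: measurable_indic.
Qed.

(** A further visit to [h] leaves [top_up] unchanged, since coordinate [h] is in any case completed
    to total t; only the weight is convolved. *)
Lemma Jop_final_hold a : Jop 0 h (final_hold a) = final_hold a.+1.
Proof.
apply/funext => x; rewrite /Jop /final_hold.
under eq_integral => u _.
  rewrite /top_up /total_time sum_addcoord addcoordD.
  rewrite (_ : u + (_ - _) = t - total_time x)%R; last by rewrite /total_time; ring.
  rewrite opprD addrA -EFinM mulrA EFinM.
  over.
rewrite /= ge0_integralZr//; last 2 first.
- apply/measurable_EFinP; apply: measurable_funM; first exact: measurable_gpow.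
  by apply: measurableT_comp; [exact: mw|exact: measurable_funB].
- by move=> u _; rewrite lee_fin mulr_ge0 ?gpow_ge0 ?w_ge0.
by rewrite w_convolution.
Qed.

Lemma Jops0_final_hold c :
  Jops (fun=> 0%N) (nseq c h) (final_hold 0) = final_hold c.
Proof. by elim: c => //= c ->; exact: Jop_final_hold. Qed.

(** The visits are sorted by coordinate. Those to [i != h] collapse to one duration with exponent
    [(c i).-1]; those to [h] are absorbed by the final hold, which counts as one visit more, whence
    the exponent [c h]. What remains is an integral over the coordinates other than [h], as in
    [simplex_measure]. *)
Lemma integral_simplex_measure (c : 'I_n -> nat) (s : seq 'I_n) :
  (forall i, i != h -> (0 < c i)%N) -> (forall i, count_mem i s = c i) ->
  Jops (fun=> 0%N) s (final_hold 0) [tuple 0%R | _ < n] =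
  \int[simplex_measure h t]_(l in B)
    ((\prod_(i | i != h) (tnth l i ^+ (c i).-1 / ((c i).-1)`!%:R)) *
     (tnth l h ^+ c h / (c h)`!%:R))%:E.
Proof.
move=> c0 cs.
pose s' := [seq lift h j | j <- enum 'I_n.-1].
rewrite (@Jops_perm _ _ _ s (flatten [seq nseq (c i) i | i <- s'] ++ nseq (c h) h));
  [|exact: measurable_final_hold|exact: final_hold_ge0|]; last first.
  apply/allP => i _ /=; apply/eqP; rewrite cs count_cat count_flatten -!map_comp.
  rewrite sumnE big_map -enumT big_enum/= count_nseq /=.
  have [->|ih] := eqVneq i h.
    rewrite big1 ?add0n ?eqxx ?mul1n// => j _.
    by rewrite count_nseq/= eq_sym (negPf (neq_lift _ _)).
  move: ih; rewrite eq_sym => /unlift_some[j -> _].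
  rewrite (bigD1 j)//= count_nseq/= eqxx mul1n big1 ?addn0 => [|j' /negPf jj'].
    by [].
  by rewrite count_nseq/= (inj_eq lift_inj) jj'.
rewrite Jops_cat Jops0_final_hold Jops0_flatten; last 3 first.
- exact: measurable_final_hold.
- exact: final_hold_ge0.
- by move=> i /mapP[j _ ->]; apply: c0; rewrite eq_sym neq_lift.
rewrite Jops_lebesgue_tuple; [|exact: measurable_final_hold|exact: final_hold_ge0].
have -> : size s' = n.-1 by rewrite size_map size_enum_ord.
pose f (l : n.-tuple R) : R :=
  ((\prod_(i | i != h) (tnth l i ^+ (c i).-1 / ((c i).-1)`!%:R)) *
     (tnth l h ^+ c h / (c h)`!%:R))%R.
have mf : measurable_fun setT (EFin \o f).
  apply/measurable_EFinP; apply: measurable_funM.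
    under eq_fun do rewrite -big_filter.
    apply: measurable_prod => i _; apply: measurable_funM => //.
    by apply: measurable_funX; exact: measurable_tnth.
  by apply: measurable_funM => //; apply: measurable_funX; exact: measurable_tnth.
have f0 l : l \in B -> 0 <= (f l)%:E.
  rewrite inE => /Bpos l0; rewrite lee_fin mulr_ge0//; last first.
    by rewrite divr_ge0// exprn_ge0// ltW.
  by apply: prodr_ge0 => i _; rewrite divr_ge0// exprn_ge0// ltW.
rewrite -[RHS](@eq_measure_integral _ _ _ _ _ (image_measure (lebesgue_tuple R n.-1)
  (@measurable_hyperplane_point R n h t))); last first.
  move=> A mA AB /=; rewrite /simplex_measure /mrestr /= setIidl//.
  exact: subset_trans Bpos.
rewrite (ge0_integral_pushforward _ _ (f := EFin \o f))//; last 2 first.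
- exact: measurable_hyperplane_point.
- exact: measurable_funTS.
rewrite [RHS]integral_mkcond; apply: eq_integral => v _.
have addv k : tnth (addcoords s' [tuple 0%R | _ < n] v) k =
    (\sum_j (k == lift h j)%:R * tnth v j)%R.
  by rewrite tnth_addcoords tnth_mktuple add0r zip_map_enum big_map big_enum.
have sumv : total_time (addcoords s' [tuple 0%R | _ < n] v) = (\sum_j tnth v j)%R.
  rewrite /total_time; under eq_bigr do rewrite addv.
  rewrite exchange_big/=; apply: eq_bigr => j _.
  rewrite (bigD1 (lift h j))//= eqxx mul1r big1 ?addr0// => k /negPf ->.
  by rewrite mul0r.
have topv : top_up (addcoords s' [tuple 0%R | _ < n] v) = hyperplane_point h t v.
  apply: eq_from_tnth => k; rewrite /top_up sumv !tnth_mktuple addv.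
  case: unliftP => [j ->|->].
    rewrite [_ == h]eq_sym (negPf (neq_lift _ _)) mul0r addr0 (bigD1 j)//= eqxx mul1r.
    rewrite big1 ?addr0// => j' /negPf jj'.
    by rewrite (inj_eq lift_inj) eq_sym jj' mul0r.
  rewrite eqxx mul1r big1 ?add0r// => j _.
  by rewrite (negPf (neq_lift _ _)) mul0r.
rewrite patchE /final_hold sumv topv gpowsE zip_map_enum big_map big_enum/=.
rewrite (_ : (v \in _ @^-1` _) = (hyperplane_point h t v \in B)); last first.
  by apply/idP/idP; rewrite !inE.
rewrite indicE.
have [hB|hB] := boolP (hyperplane_point h t v \in B); last by rewrite mulr0 mule0.
(* On [B] all coordinates are positive, so the truncated weights are plain powers. *)
have hpos := Bpos (set_mem hB).
have tpos : (0 < t - \sum_j tnth v j)%R.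
  by have := hpos h; rewrite tnth_mktuple unlift_none.
rewrite mulr1 -EFinM /f tnth_mktuple unlift_none w_gt0//; congr (_ * _)%:E.
rewrite (reindex_omap (lift h) (unlift h)) => [|i ih]; last first.
  by case: unliftP ih => [j ->|->]; rewrite ?eqxx.
apply: congr_big => // [j|j _]; first by rewrite liftK eqxx eq_sym neq_lift.
have := hpos (lift h j); rewrite !tnth_mktuple liftK => vj.
by rewrite /gpow vj.
Qed.

End simplex_integral.

(** * The Dirichlet integral *)

Section dirichlet_integral.
Context {R : realType}.
Local Notation mu := (@lebesgue_measure R).
Local Open Scope ereal_scope.
Variables (n : nat) (h : 'I_n) (t : R).

Lemma Jops0_gpow (s : seq 'I_n) (x : n.-tuple R) :
  Jops (fun=> 0%N) s (fun x => (gpow 0 (t - total_time x))%:E) x =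
  (gpow (size s) (t - total_time x))%:E.
Proof.
elim: s x => //= i s IH x; rewrite /Jop.
under eq_integral => u _.
  rewrite IH /total_time sum_addcoord opprD addrA -EFinM.
  over.
by rewrite /= gpow_convolutionC.
Qed.

(** The integrand is the occupation density of a list of visits. Without the indicator of the
    orthant the convolutions simply add up by [Jops0_gpow], and the indicator is automatic wherever
    the weights do not vanish. *)
Lemma dirichlet_integral (a : 'I_n -> nat) : (0 < t)%R ->
  \int[simplex_measure h t]_(l in positive_orthant R n)
    (\prod_i (tnth l i ^+ a i / (a i)`!%:R))%:E =
  (t ^+ (\sum_i a i + n.-1) / (\sum_i a i + n.-1)`!%:R)%:E.
Proof.
move=> t0.
(* A coordinate other than [h] needs one visit more than its exponent; for [h] the final hold
   supplies it. Hence the [n.-1] in the total. *)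
pose c i := (a i + (i != h))%N.
pose s := flatten [seq nseq (c i) i | i <- enum 'I_n].
have cs i : count_mem i s = c i.
  rewrite /s count_flatten -map_comp sumnE big_map big_enum/= (bigD1 i)//=.
  rewrite count_nseq/= eqxx mul1n big1 ?addn0// => j /negPf ji.
  by rewrite count_nseq/= ji.
have sz : size s = (\sum_i a i + n.-1)%N.
  rewrite /s size_flatten /shape -map_comp sumnE big_map big_enum/=.
  under eq_bigr do rewrite size_nseq.
  rewrite big_split/=; congr addn.
  transitivity (\sum_(i < n | i != h) 1)%N.
    by rewrite [RHS]big_mkcond; apply: eq_bigr => i _; case: (i != h).
  by rewrite sum1_card cardC1 card_ord.
transitivity (\int[simplex_measure h t]_(l in positive_orthant R n)
    ((\prod_(i | i != h) (tnth l i ^+ (c i).-1 / ((c i).-1)`!%:R)) *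
     (tnth l h ^+ c h / (c h)`!%:R))%:E).
  apply: eq_integral => l _; rewrite [in LHS](bigD1 h)//= mulrC /c eqxx addn0.
  by congr (_ * _)%:E; apply: eq_bigr => i ->; rewrite addn1.
have c0 i : i != h -> (0 < c i)%N by move=> ih; rewrite /c ih addn1.
have gE b u : (0 < u)%R -> gpow b u = (u ^+ b / b`!%:R)%R :> R by rewrite /gpow => ->.
have mO : measurable (positive_orthant R n) by exact: measurable_positive_orthant.
rewrite -(integral_simplex_measure t gpow_ge0 (@measurable_gpow R)
  (@gpow_convolutionC R) gE mO (@subset_refl _ _) c0 cs).
rewrite -sz.
have -> : (t ^+ size s / (size s)`!%:R)%R = gpow (size s) (t - total_time [tuple 0%R | _ < n]).
  rewrite /total_time big1 ?subr0 /gpow ?t0// => j _; by rewrite tnth_mktuple.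
rewrite -Jops0_gpow !Jops_lebesgue_tuple; last 4 first.
- apply/measurable_EFinP; apply: measurableT_comp; first exact: measurable_gpow.
  by apply: measurable_funB => //; exact: measurable_total_time.
- by move=> x; rewrite lee_fin gpow_ge0.
- by apply: measurable_final_hold => //; exact: measurable_gpow.
- by move=> x; apply: final_hold_ge0; exact: gpow_ge0.
apply: eq_integral => v _; rewrite /final_hold indicE.
set x := addcoords _ _ _.
have [->|g0] := eqVneq (gpows (fun=> 0%N) s v) 0%R; first by rewrite !mul0e.
congr (_ * _%:E); rewrite /gpow; case: ifPn => [tx|]; last by rewrite mul0r.
(* Each coordinate other than [h] occurs in [s] and receives a positive duration; coordinate [h]
   gets the positive time left. *)
rewrite mem_set ?mulr1// => k.
have vpos p : p \in zip s v -> (0 < p.2)%R.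
  move=> pv; move: g0; rewrite gpowsE (big_rem p)//= mulf_eq0 negb_or => /andP[+ _].
  by rewrite /gpow; case: ifP; rewrite // eqxx.
have xge i : (0 <= tnth x i)%R.
  rewrite tnth_addcoords tnth_mktuple add0r big_seq sumr_ge0// => p /vpos p0.
  by rewrite mulr_ge0// ltW.
rewrite tnth_mktuple; have [->|kh] := eqVneq k h.
  by rewrite mul1r ltr_wpDl.
rewrite mul0r addr0 tnth_addcoords tnth_mktuple add0r.
have /(nthP k)[p ps sp] : k \in s.
  by rewrite -has_pred1 has_count cs /c kh addn1.
pose q := (k, tnth v (Ordinal ps)).
have qv : q \in zip s v.
  apply/(nthP (k, 0%R)); exists p; first by rewrite size_zip size_tuple minnn.
  by rewrite nth_zip ?size_tuple//= sp /q (tnth_nth 0%R).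
rewrite (big_rem q)//= eqxx mul1r ltr_pwDl//; first exact: (vpos q).
rewrite big_seq sumr_ge0// => q' /mem_rem/vpos q0.
by rewrite mulr_ge0// ltW.
Qed.

End dirichlet_integral.

(** * The Gamma function at positive integers *)

Section gamma_function.
Context {R : realType}.
Local Notation mu := (@lebesgue_measure R).
Local Open Scope ereal_scope.

Lemma integral_gpow0_expR : \int[mu]_u (gpow 0 u * expR (- u))%:E = 1.
Proof.
rewrite -(@integral_exponential_pdf R 1)//.
transitivity (\int[mu]_(u in `]0%R, +oo[) (expR (- u))%:E).
  rewrite [RHS]integral_mkcond; apply: eq_integral => u _.
  rewrite patchE mem_setE in_itv/= andbT /gpow expr0 fact0 divr1.
  by case: ifP => _; rewrite ?mul0r ?mul1r.
rewrite integral_itv_obnd_cbnd; last first.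
  apply/measurable_EFinP; apply: measurable_funTS.
  by apply: measurableT_comp => //; exact: measurable_funN.
rewrite [LHS]integral_mkcond; apply: eq_integral => u _.
rewrite /exponential_pdf !patchE.
by case: ifP => _ //; rewrite mul1r mulN1r.
Qed.

(** The function exp(-x) is fixed by [Jop 0], hence by [Jop a] through [Jop_succ]; evaluating at 0
    replaces integrations by parts. *)
Lemma integral_gpow_expR a : \int[mu]_u (gpow a u * expR (- u))%:E = 1.
Proof.
pose g (x : 1.-tuple R) := (expR (- tnth x ord0))%:E.
have mg : measurable_fun setT g.
  apply/measurable_EFinP; apply: measurableT_comp => //.
  by apply: measurable_funN; exact: measurable_tnth.
have g0 x : 0 <= g x by rewrite lee_fin expR_ge0.
have J0 : Jop 0 ord0 g = g.
  apply/funext => x; rewrite /Jop /g.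
  under eq_integral => u _.
    rewrite tnth_mktuple eqxx mul1r opprD expRD [(expR _ * _)%R]mulrC -EFinM mulrA EFinM.
    over.
  rewrite /= ge0_integralZr//; last 2 first.
  - apply/measurable_EFinP; apply: measurable_funM; first exact: measurable_gpow.
    by apply: measurableT_comp => //; exact: measurable_funN.
  - by move=> u _; rewrite lee_fin mulr_ge0 ?gpow_ge0 ?expR_ge0.
  by rewrite integral_gpow0_expR mul1e.
have Ja : Jop a ord0 g = g.
  by elim: a => // a IH; apply/funext => x; rewrite -Jop_succ// IH J0.
have := congr1 (fun f => f [tuple 0%R]) Ja; rewrite /Jop /g.
rewrite [X in (expR (- X))%:E](_ : _ = 0%R)// oppr0 expR0 => <-.
by apply: eq_integral => u _; rewrite tnth_mktuple eqxx mul1r add0r EFinM.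
Qed.

Lemma Gamma_nat m : Gamma (m.+1%:R : R) = m`!%:R.
Proof.
rewrite /Gamma /Rintegral integral_mkcond.
transitivity (fine (\int[mu]_u (m`!%:R%:E * (gpow m u * expR (- u))%:E))).
  congr fine; apply: eq_integral => u _.
  rewrite patchE mem_setE in_itv/= andbT /gpow; case: ifPn => u0; last first.
    by rewrite mul0r mule0.
  rewrite -natr1 addrK powR_mulrn ?ltW// -EFinM; congr EFin.
  by rewrite mulrA mulrCA divff ?mulr1// pnatr_eq0 -lt0n fact_gt0.
rewrite ge0_integralZl_EFin//.
- by rewrite integral_gpow_expR mule1.
- by move=> u _; rewrite lee_fin mulr_ge0 ?gpow_ge0 ?expR_ge0.
- apply/measurable_EFinP; apply: measurable_funM; first exact: measurable_gpow.
  by apply: measurableT_comp => //; exact: measurable_funN.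
Qed.

End gamma_function.

(** * Independent exponential holding times *)

Section change_of_law.
Context {R : realType}.
Local Open Scope ereal_scope.

Import HBNNSimple.

Section simple_approximation.
Context d1 d (W : measurableType d1) (T : measurableType d).
Variables (mu : {measure set W -> \bar R}) (X : W -> T) (h : W -> R).
Hypotheses (mX : measurable_fun setT X) (mh : measurable_fun setT h).
Hypothesis h0 : forall x, (0 <= h x)%R.
Variables (f : T -> \bar R) (mf : measurable_fun setT f).
Hypothesis f0 : forall x, 0 <= f x.

Lemma integral_nnsfun_approx :
  \int[mu]_x (f (X x) * (h x)%:E) =
  limn (fun n => \sum_(r \in range (nnsfun_approx measurableT mf n))
    (r%:E * \int[mu]_x ((\1_(nnsfun_approx measurableT mf n @^-1` [set r]) (X x))%:E *
      (h x)%:E))).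
Proof.
pose f_ := nnsfun_approx measurableT mf.
transitivity (limn (fun n => \int[mu]_x ((f_ n (X x))%:E * (h x)%:E))).
  rewrite -monotone_convergence//; last 3 first.
  - move=> n; apply: emeasurable_funM; apply/measurable_EFinP => //.
    exact: measurableT_comp.
  - by move=> n x _; rewrite mule_ge0// lee_fin.
  - move=> x _ m n mn; rewrite lee_wpmul2r// ?lee_fin//.
    exact/lefP/nd_nnsfun_approx.
  apply: eq_integral => x _; apply/esym/cvg_lim => //.
  by apply: cvgeZr => //; apply: cvg_nnsfun_approx.
congr (limn _); apply/funext => n.
have mind r : measurable_fun setT (fun x : W => (\1_(f_ n @^-1` [set r]) (X x) : R)).
  apply: (measurableT_comp _ mX); exact: measurable_indic.
transitivity (\int[mu]_x \sum_(r \in range (f_ n))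
    (r * (\1_(f_ n @^-1` [set r]) (X x) * h x))%:E).
  apply: eq_integral => x _; rewrite {1}fimfunE -EFinM fsumEFin//; congr EFin.
  rewrite !fsbig_finite//= mulr_suml; apply: eq_bigr => r _; by rewrite mulrA.
rewrite ge0_integral_fsum//; last 2 first.
- move=> r; apply/measurable_EFinP; apply: measurable_funM => //.
  exact: measurable_funM.
- move=> r x _; rewrite mulrA lee_fin mulr_ge0//.
  by have := nnfun_muleindic_ge0 (f_ n) r (X x).
apply: eq_fsbigr => r; rewrite inE => -[y _ yr].
have r0 : (0 <= r)%R by rewrite -yr.
rewrite -ge0_integralZl_EFin//.
- by move=> x _; rewrite lee_fin mulr_ge0.
- by apply/measurable_EFinP; apply: measurable_funM.
Qed.

End simple_approximation.

(** Monotone convergence along simple functions. The weights [h1] and [h2] allow one factor of a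
    product to be treated while the others are carried along. *)
Lemma eq_integral_indic d1 d2 d (W1 : measurableType d1) (W2 : measurableType d2)
    (T : measurableType d) (mu1 : {measure set W1 -> \bar R})
    (mu2 : {measure set W2 -> \bar R}) (X1 : W1 -> T) (X2 : W2 -> T)
    (h1 : W1 -> R) (h2 : W2 -> R) :
  measurable_fun setT X1 -> measurable_fun setT X2 ->
  measurable_fun setT h1 -> measurable_fun setT h2 ->
  (forall x, (0 <= h1 x)%R) -> (forall x, (0 <= h2 x)%R) ->
  (forall A, measurable A ->
    \int[mu1]_x ((\1_A (X1 x))%:E * (h1 x)%:E) =
    \int[mu2]_x ((\1_A (X2 x))%:E * (h2 x)%:E)) ->
  forall f : T -> \bar R, measurable_fun setT f -> (forall x, 0 <= f x) ->
  \int[mu1]_x (f (X1 x) * (h1 x)%:E) = \int[mu2]_x (f (X2 x) * (h2 x)%:E).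
Proof.
move=> mX1 mX2 mh1 mh2 h10 h20 H f mf f0.
rewrite !(integral_nnsfun_approx _ _ _ _ mf f0)//.
congr (limn _); apply/funext => n; apply: eq_fsbigr => r _.
by rewrite H//; exact: measurable_sfunP.
Qed.

Lemma integral_mrestr d (W : measurableType d) (mu : {measure set W -> \bar R})
    (D : set W) (mD : measurable D) (f : W -> \bar R) :
  measurable_fun setT f -> (forall x, 0 <= f x) ->
  \int[mrestr mu mD]_x f x = \int[mu]_(x in D) f x.
Proof.
move=> mf f0; rewrite -(setUv D) ge0_integral_setU//; last 3 first.
- exact: measurableC.
- by rewrite setUv.
- exact/disj_setPCl.
rewrite [X in _ + X](_ : _ = 0); last first.
  rewrite -(integral_measure_zero (~` D) f); apply: eq_measure_integral => A mA AD.
  by rewrite /= /mrestr (_ : A `&` D = set0) ?measure0//; apply/disjoints_subset.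
rewrite adde0; apply: eq_measure_integral => A mA AD.
by rewrite /= /mrestr setIidl.
Qed.

Section finite_image.
Context d1 d2 (W : measurableType d1) (T : measurableType d2).
Variables (mu : {finite_measure set W -> \bar R}) (X : W -> T).
Hypothesis mX : measurable_fun setT X.

Definition finite_image : set T -> \bar R := image_measure mu mX.
HB.instance Definition _ := Measure.on finite_image.

Let finite_image_fin : fin_num_fun finite_image.
Proof.
move=> A mA; apply: fin_num_measure.
by rewrite -[_ @^-1` _]setTI; exact: mX.
Qed.

HB.instance Definition _ := Measure_isFinite.Build _ _ _ finite_image finite_image_fin.

End finite_image.

End change_of_law.

(** * The exponential law *)

Section exponential_law.
Context {R : realType}.
Local Notation mu := (@lebesgue_measure R).
Local Open Scope ereal_scope.

Definition exp_weight (u : R) : R := (gpow 0 u * expR (- u))%R.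

Lemma exp_weight_ge0 u : (0 <= exp_weight u)%R.
Proof. by rewrite mulr_ge0 ?gpow_ge0 ?expR_ge0. Qed.

Lemma measurable_exp_weight : measurable_fun setT exp_weight.
Proof.
apply: measurable_funM; first exact: measurable_gpow.
by apply: measurableT_comp => //; exact: measurable_funN.
Qed.

Definition exp_law (A : set (measurableTypeR R)) : \bar R :=
  \int[mu]_(u in A) (exp_weight u)%:E.

Let exp_law0 : exp_law set0 = 0.
Proof. exact: integral_set0. Qed.

Let exp_law_ge0 A : 0 <= exp_law A.
Proof. by apply: integral_ge0 => u _; rewrite lee_fin exp_weight_ge0. Qed.

Let exp_law_sigma_additive : semi_sigma_additive exp_law.
Proof.
move=> /= F mF tF mUF; rewrite /exp_law; apply: cvg_toP.
  apply: ereal_nondecreasing_is_cvgn => m n mn.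
  by apply: lee_sum_nneg_natr => // k _ _; exact: exp_law_ge0.
rewrite ge0_integral_bigcup//=.
- by apply/measurable_funTS/measurable_EFinP; exact: measurable_exp_weight.
- by move=> u _; rewrite lee_fin exp_weight_ge0.
Qed.

HB.instance Definition _ := isMeasure.Build _ _ _ exp_law
  exp_law0 exp_law_ge0 exp_law_sigma_additive.

Let exp_lawT : exp_law setT = 1.
Proof. exact: integral_gpow_expR. Qed.

HB.instance Definition _ := @Measure_isProbability.Build _ _ R exp_law exp_lawT.

(** The maximum covers negative endpoints: rays from all reals are used to generate the Borel
    sets. *)
Lemma exp_law_ray u : exp_law `]u, +oo[%classic = (expR (- Num.max u 0))%:E.
Proof.
pose c := Num.max u 0%R.
transitivity (\int[mu]_x ((expR (- c))%:E * (gpow 0 (x - c) * expR (- (x - c)))%:E)).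
  rewrite /exp_law integral_mkcond; apply: eq_integral => x _.
  rewrite patchE mem_setE in_itv/= andbT -EFinM mulrCA -expRD.
  rewrite (_ : (- c - (x - c) = - x)%R); last by ring.
  rewrite /exp_weight /gpow subr_gt0 expr0 fact0 divr1 /c gt_max.
  by case: (u < x)%R; case: (0 < x)%R; rewrite ?mul1r ?mul0r.
rewrite ge0_integralZl_EFin ?expR_ge0//; last 2 first.
- by move=> x _; rewrite lee_fin exp_weight_ge0.
- apply/measurable_EFinP; apply: (measurableT_comp measurable_exp_weight).
  exact: measurable_funB.
rewrite (integral_lebesgue_shift (f := EFin \o exp_weight) (- c)); last 2 first.
- by apply/measurable_EFinP; exact: measurable_exp_weight.
- by move=> x; rewrite lee_fin exp_weight_ge0.
by rewrite [X in _ * X]integral_gpow_expR mule1.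
Qed.

Lemma integral_exp_law (f : R -> \bar R) : measurable_fun setT f ->
  (forall x, 0 <= f x) ->
  \int[exp_law]_u f u = \int[mu]_u (f u * (exp_weight u)%:E).
Proof.
move=> mf f0; transitivity (\int[exp_law]_u (f u * 1%:E)).
  by under [RHS]eq_integral do rewrite mule1.
have E A : measurable A ->
    \int[exp_law]_u ((\1_A (id u))%:E * (cst 1%R u : R)%:E) =
    \int[mu]_u ((\1_A (id u))%:E * (exp_weight u)%:E).
  move=> mA; under eq_integral do rewrite mule1.
  rewrite integral_indic// setIT /exp_law /= /exp_law integral_mkcond.
  apply: eq_integral => u _; rewrite patchE indicE.
  by case: ifP => _; rewrite ?mul1e ?mul0e.
have mid : measurable_fun setT (@id (measurableTypeR R)) by exact: measurable_id.
have mcst : measurable_fun setT (cst 1%R : measurableTypeR R -> R) by [].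
exact: (eq_integral_indic mid mid mcst measurable_exp_weight
  (fun=> ler01) exp_weight_ge0 E mf f0).
Qed.

(* A positive time S whose tails are exponential conditionally on U is an
   independent exponential time. *)
Lemma integral_exponential_independent d1 d2 (W : measurableType d1)
    (T : measurableType d2) (Q : {measure set W -> \bar R}) (D : set W)
    (U : W -> T) (S : W -> R) :
  measurable D -> Q D < +oo -> measurable_fun setT U -> measurable_fun setT S ->
  (forall w, (0 < S w)%R) ->
  (forall A u, measurable A -> (0 <= u)%R ->
    Q (D `&` (U @^-1` A `&` [set w | (u < S w)%R])) =
    Q (D `&` U @^-1` A) * (expR (- u))%:E) ->
  forall G : T * measurableTypeR R -> \bar R,
  measurable_fun setT G -> (forall z, 0 <= G z) ->
  \int[Q]_(w in D) G (U w, S w) =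
  \int[Q]_(w in D) \int[mu]_u (G (U w, u) * (exp_weight u)%:E).
Proof.
move=> mD Doo mU mS S0 H G mG G0.
have mS' : measurable_fun setT (S : W -> measurableTypeR R) by exact: mS.
pose mu' := mfrestr mD Doo.
have mUS : measurable_fun setT (fun w => (U w, S w : measurableTypeR R)).
  exact/measurable_fun_pair.
have muE A : measurable A -> mu' A = Q (D `&` A) by move=> mA; rewrite /mu' /mfrestr /mrestr setIC.
(* By uniqueness of product measures rectangles suffice; for a fixed first side, two finite measures
   of the second side are compared on rays, where the hypothesis gives their values. *)
have lawE C : measurable C ->
    (finite_image mu' mU \x exp_law) C = finite_image mu' mUS C.
  apply: product_measure_unique => A B mA mB.
  have mUA : measurable (U @^-1` A) by rewrite -[_ @^-1` _]setTI; exact: mU.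
  have UAfin : Q (D `&` U @^-1` A) \is a fin_num.
    rewrite ge0_fin_numE//; apply: (le_lt_trans _ Doo).
    by apply: le_measure; rewrite ?inE//; exact: measurableI.
  have c0 : (0 <= fine (Q (D `&` U @^-1` A)))%R by exact: fine_ge0.
  pose m1 : {measure set (measurableTypeR R) -> \bar R} :=
    image_measure (mrestr mu' mUA) mS'.
  pose m2 : {measure set (measurableTypeR R) -> \bar R} :=
    mscale (NngNum c0) exp_law.
  have m12 : m1 B = m2 B.
    apply: (@measure_unique _ R (measurableTypeR R) (@RGenOInfty.G R)
      (fun n => `](- n%:R)%R, +oo[%classic) _ _ _ _ m1 m2 _ _ B mB) => //.
    - exact: RGenOInfty.measurableE.
    - move=> _ _ [x ->] [y ->]; exists (Num.max x y).
      by apply/seteqP; split => z /=; rewrite !in_itv/= !andbT gt_max => /andP.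
    - by move=> i; eexists.
    - rewrite -subTset => x _ /=; exists (Num.truncn `|x|).+1 => //=.
      rewrite in_itv/= andbT ltrNl.
      by rewrite (le_lt_trans (ler_norm (- x)%R))// normrN truncnS_gt.
    (* For a negative endpoint the hypothesis is applied at 0, which is enough because [S] is
       positive. *)
    - move=> _ [x ->]; rewrite -[m2 _]/((NngNum c0)%:num%:E * exp_law `]x, +oo[%classic).
      rewrite exp_law_ray fineK//.
      rewrite -H ?le_max ?lexx ?orbT//.
      rewrite /m1 /= /pushforward /mrestr /= /mfrestr /mrestr.
      congr (Q _); apply/seteqP; split => w /=; rewrite in_itv/= andbT gt_max.
        by move=> [[-> ?] ?]; rewrite S0.
      by move=> [? [? /andP[]]].
    - move=> n; apply: (le_lt_trans _ Doo); rewrite /m1 /= /pushforward /mrestr /= /mfrestr /mrestr.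
      apply: le_measure; rewrite ?inE//; apply: measurableI => //; apply: measurableI => //.
      by rewrite -[_ @^-1` _]setTI; exact: mS.
  transitivity (m1 B).
    rewrite /m1 /= /finite_image /= /pushforward /mrestr /=.
    by congr (mu' _); apply/seteqP; split => w /= [].
  rewrite m12 -[m2 _]/((NngNum c0)%:num%:E * exp_law B) fineK//; congr (_ * _).
  by rewrite -muE.
transitivity (\int[finite_image mu' mUS]_z G z).
  rewrite /finite_image (ge0_integral_pushforward mUS mu')//.
  rewrite -integral_mrestr//.
    exact: measurableT_comp mG mUS.
transitivity (\int[finite_image mu' mU \x exp_law]_z G z).
  by apply: eq_measure_integral => C mC _; first [exact: lawE | exact/esym/lawE].
rewrite fubini_tonelli1//.
have mF : measurable_fun setT (fubini_F exp_law G).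
  exact: measurable_fun_fubini_tonelli_F.
have F0 x : 0 <= fubini_F exp_law G x by apply: integral_ge0.
rewrite /finite_image (ge0_integral_pushforward mU mu')//.
rewrite integral_mrestr//; [|exact: measurableT_comp mF mU|by move=> w; exact: F0].
apply: eq_integral => w _; rewrite /= /fubini_F integral_exp_law//.
by apply: measurableT_comp mG _; exact/measurable_fun_pair.
Qed.

End exponential_law.

(** * Joint law of a path and its occupation times *)

Section holding_times.
Context {R : realType}.
Local Notation mu := (@lebesgue_measure R).
Local Open Scope ereal_scope.

Lemma Jops_scale n a (s : seq 'I_n) (c : R) (g : n.-tuple R -> \bar R) x :
  (0 <= c)%R -> measurable_fun setT g -> (forall x, 0 <= g x) ->
  Jops a s (fun x => c%:E * g x) x = c%:E * Jops a s g x.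
Proof.
move=> c0 mg g0; elim: s x => //= i s IH x.
rewrite /Jop -ge0_integralZl_EFin//.
- by apply: eq_integral => u _; rewrite IH muleCA.
- by move=> u _; rewrite mule_ge0 ?lee_fin ?gpow_ge0//; exact: Jops_ge0.
- by apply: measurable_Jop_integrand => //; exact: measurable_Jops.
Qed.

Context d (W : measurableType d) (V : eqType) (Q : {measure set W -> \bar R}).
Variables (Y : nat -> W -> V) (S : nat -> W -> R) (y : nat -> V) (N : nat) (c : R).
Variables (n : nat) (idx : nat -> 'I_n).
Hypothesis Qoo : Q setT < +oo.
Hypothesis mY : forall m, measurable (Y m @^-1` [set y m]).
Hypothesis mS : forall m, measurable_fun setT (S m).
Hypothesis S_gt0 : forall m w, (0 < S m w)%R.
Hypothesis QYS : forall s : nat -> R, (forall m, 0 <= s m)%R ->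
  Q [set w | forall m, (m <= N)%N -> Y m w = y m /\ (s m < S m w)%R] =
  (c * \prod_(0 <= m < N.+1) expR (- s m))%:E.

Fixpoint occupation m w : n.-tuple R :=
  if m is m'.+1 then addcoord (occupation m' w) (idx m') (S m' w)
  else [tuple 0%R | _ < n].

(** Thresholds bear only on the holding times from index [m] on; the earlier ones are free, being
    already expressed by integrals. *)
Definition tails m (s : nat -> R) : set W :=
  [set w | forall j, (j <= N)%N -> Y j w = y j /\ ((m <= j)%N -> (s j < S j w)%R)].

Lemma measurable_occupation m : measurable_fun setT (occupation m).
Proof. by elim: m => //= m IH; exact: measurable_addcoord. Qed.

Lemma measurable_tails m s : measurable (tails m s).
Proof.
rewrite (_ : tails m s = \bigcap_(j < N.+1)
  (Y j @^-1` [set y j] `&` (if (m <= j)%N then [set w | (s j < S j w)%R] else setT))).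
  apply: bigcap_measurableType => j _; apply: measurableI => //.
  case: ifPn => // _.
  rewrite (_ : [set w | _] = S j @^-1` `]s j, +oo[%classic); last first.
    by apply/seteqP; split=> w /=; rewrite in_itv/= andbT.
  by rewrite -[X in measurable X]setTI; exact: mS.
apply/seteqP; split => w /= H j jN.
  by have [Yj Hs] := H j jN; split=> //; case: ifPn.
by have [? Hs] := H j jN; split=> // mj; move: Hs; rewrite mj.
Qed.

Lemma tails_fin m s : Q (tails m s) < +oo.
Proof.
apply: (le_lt_trans _ Qoo); apply: le_measure; rewrite ?inE//.
exact: measurable_tails.
Qed.

(** Gathers the factors exp(-S) of the completed visits into a function of the occupation vector, so
    that only the weights [gpow 0] remain in the integrals. *)
Definition damped (g : n.-tuple R -> \bar R) (x : n.-tuple R) : \bar R :=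
  (expR (- total_time x))%:E * g x.

Definition steps_before m := [seq idx j | j <- iota 0 m].

(** Induction invariant: the first [m] holding times are described by Lebesgue integrals, the later
    ones still by their tails. At [m = 0] it is [QYS]. *)
Let law_at m := forall s g, (forall j, 0 <= s j)%R -> measurable_fun setT g ->
  (forall x, 0 <= g x) ->
  \int[Q]_(w in tails m s) g (occupation m w) =
  (c * \prod_(m <= j < N.+1) expR (- s j))%:E *
    Jops (fun=> 0%N) (steps_before m) (damped g) [tuple 0%R | _ < n].

(** By [law_at m], the tail of [S m] given the occupation of the first [m] visits is exponential, so
    [integral_exponential_independent] applies. *)
Let law_step m : (m <= N)%N -> law_at m ->
  forall s (G : n.-tuple R * measurableTypeR R -> \bar R),
  (forall j, 0 <= s j)%R -> measurable_fun setT G -> (forall z, 0 <= G z) ->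
  \int[Q]_(w in tails m.+1 s) G (occupation m w, S m w) =
  (c * \prod_(m.+1 <= j < N.+1) expR (- s j))%:E *
    Jops (fun=> 0%N) (steps_before m)
      (damped (fun x => \int[mu]_u (G (x, u) * (exp_weight u)%:E)))
      [tuple 0%R | _ < n].
Proof.
move=> mN IH s G s0 mG G0.
(* Threshold u at index m in [tails m] amounts to intersecting [tails m.+1] with u < S_m; by
   positivity of S, u = 0 imposes nothing. *)
pose s' u j := if j == m then u else s j.
have s'0 u : (0 <= u)%R -> forall j, (0 <= s' u j)%R.
  by move=> u0 j; rewrite /s'; case: ifP.
have prod_s' u : (\prod_(m <= j < N.+1) expR (- s' u j) =
    expR (- u) * \prod_(m.+1 <= j < N.+1) expR (- s j))%R.
  rewrite big_ltn// /s' eqxx; congr (_ * _)%R; apply: eq_big_nat => j /andP[mj _].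
  by rewrite gtn_eqF.
have tails_s' u : tails m (s' u) = tails m.+1 s `&` [set w | (u < S m w)%R].
  apply/seteqP; split => w /=.
    move=> H; split; last by have [_] := H m mN; rewrite /s' eqxx; apply.
    move=> j jN; have [-> Hj] := H j jN; split=> // mj; have := Hj (ltnW mj).
    by rewrite /s' gtn_eqF.
  move=> [H um] j jN; have [-> Hj] := H j jN; split=> //.
  by rewrite leq_eqVlt /s' => /predU1P[<-|mj]; rewrite ?eqxx// gtn_eqF// Hj.
have tails0 : tails m (s' 0%R) = tails m.+1 s.
  by rewrite tails_s'; apply/setIidPl => w _ /=.
have mI := measurable_occupation m.
rewrite (integral_exponential_independent (measurable_tails m.+1 s)
  (tails_fin m.+1 s) mI (mS m) (S_gt0 m) _ mG G0); last first.
  move=> A u mA u0.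
  have E v : (0 <= v)%R -> Q (tails m (s' v) `&` occupation m @^-1` A) =
     (c * \prod_(m <= j < N.+1) expR (- s' v j))%:E *
       Jops (fun=> 0%N) (steps_before m) (damped (EFin \o \1_A)) [tuple 0%R | _ < n].
    move=> v0; rewrite -IH//; [|exact: s'0|
      by apply/measurable_EFinP; exact: measurable_indic|by move=> x; rewrite lee_fin].
    rewrite (_ : (fun w => _) = EFin \o \1_(occupation m @^-1` A))//.
    rewrite integral_indic; [by rewrite setIC|exact: measurable_tails|].
    by rewrite -[_ @^-1` _]setTI; exact: mI.
  rewrite setIA setIAC -tails_s' -tails0 !E// !prod_s' oppr0 expR0 mul1r.
  by rewrite mulrCA EFinM -muleA muleC.
rewrite -tails0.
rewrite (IH _ (fun x => \int[mu]_u (G (x, u) * (exp_weight u)%:E)))//;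
  [|exact: s'0| |]; last 2 first.
- pose G' (z : n.-tuple R * measurableTypeR R) := G z * (exp_weight z.2)%:E.
  have mG' : measurable_fun setT G'.
    apply: emeasurable_funM => //; apply/measurable_EFinP.
    by apply: (measurableT_comp measurable_exp_weight).
  rewrite (_ : (fun x => _) = fubini_F mu G')//.
  apply: measurable_fun_fubini_tonelli_F => // z.
  by rewrite mule_ge0// lee_fin exp_weight_ge0.
- by move=> x; apply: integral_ge0 => u _; rewrite mule_ge0// lee_fin exp_weight_ge0.
by rewrite prod_s' oppr0 expR0 mul1r.
Qed.

Let law_atP m : (m <= N.+1)%N -> law_at m.
Proof.
elim: m => [_|m IH mN].
  move=> s g s0 mg g0; rewrite /= integral_cst; last exact: measurable_tails.
  rewrite /damped /total_time [X in expR (- X)](_ : _ = 0%R); last first.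
    by rewrite big1// => j _; rewrite tnth_mktuple.
  rewrite oppr0 expR0 mul1e muleC -QYS//; congr (Q _ * _).
  apply/seteqP; split => w H j jN; have [-> Hj] := H j jN; split=> //; exact: Hj.
move=> s g s0 mg g0.
have mG : measurable_fun setT (fun z : n.-tuple R * measurableTypeR R =>
    g (addcoord z.1 (idx m) z.2)).
  by apply: (measurableT_comp mg); exact: measurable_addcoord.
rewrite (law_step mN (IH (ltnW mN)) s0 mG)//.
rewrite /steps_before -addn1 iotaD map_cat Jops_cat/= add0n.
congr (_ * Jops _ _ _ _); apply/funext => x.
rewrite /damped /Jop -ge0_integralZl_EFin ?expR_ge0//.
- apply: eq_integral => u _; rewrite /total_time sum_addcoord opprD expRD.
  rewrite [g _ * _]muleC !muleA -!EFinM /exp_weight /=; congr (_%:E * _); ring.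
- by move=> u _; rewrite mule_ge0// lee_fin exp_weight_ge0.
- apply: emeasurable_funM.
    by apply: (measurableT_comp mg); exact: measurable_addcoord.
  by apply/measurable_EFinP; exact: measurable_exp_weight.
Qed.

Lemma occupation_time m w : total_time (occupation m w) = (\sum_(j < m) S j w)%R.
Proof.
elim: m => [|m IH] /=.
  by rewrite big_ord0 /total_time big1// => j _; rewrite tnth_mktuple.
by rewrite /total_time sum_addcoord big_ord_recr/= -IH.
Qed.

Variables (h : 'I_n) (t : R) (B : set (n.-tuple R)).
Hypothesis mB : measurable B.

(** The current hold must exceed the time left, t - total, which has probability exp(-(t - total));
    with the damping exp(-total) this leaves the constant exp(-t). *)
Lemma path_law :
  Q [set w | [/\ forall j, (j <= N)%N -> Y j w = y j,
     (\sum_(j < N) S j w <= t < \sum_(j < N.+1) S j w)%R &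
     B (top_up h t (occupation N w))]] =
  (c * expR (- t))%:E *
  Jops (fun=> 0%N) (steps_before N) (final_hold h t B hpow 0) [tuple 0%R | _ < n].
Proof.
set A := [set w | _].
pose C : set (n.-tuple R * measurableTypeR R) :=
  [set z | (total_time z.1 <= t)%R /\ (t < total_time z.1 + z.2)%R /\ B (top_up h t z.1)].
have mC : measurable C.
  have mT : measurable_fun setT
      (fun z : n.-tuple R * measurableTypeR R => total_time z.1).
    exact: (measurableT_comp (@measurable_total_time _ _)).
  have mTD : measurable_fun setT
      (fun z : n.-tuple R * measurableTypeR R => total_time z.1 + z.2 : R)%R.
    by apply: measurable_funD.
  have mU : measurable_fun setT
      (fun z : n.-tuple R * measurableTypeR R => top_up h t z.1).
    exact: (measurableT_comp (@measurable_top_up _ _ _ _)).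
  rewrite (_ : C = (fun z => total_time z.1) @^-1` `]-oo, t]%classic `&`
    ((fun z => total_time z.1 + z.2)%R @^-1` `]t, +oo[%classic `&`
     (fun z => top_up h t z.1) @^-1` B)).
    apply: measurableI.
      by rewrite -[X in measurable X]setTI; exact: mT.
    apply: measurableI.
      by rewrite -[X in measurable X]setTI; exact: mTD.
    by rewrite -[X in measurable X]setTI; exact: mU.
  by apply/seteqP; split => z; rewrite /C/= !in_itv/= andbT.
have mD : measurable (tails N.+1 (fun=> 0%R)) by exact: measurable_tails.
have mOS : measurable_fun setT
    (fun w => (occupation N w, S N w : measurableTypeR R)).
  by apply/measurable_fun_pair; [exact: measurable_occupation|exact: mS].
have -> : A = tails N.+1 (fun=> 0%R) `&` (fun w => (occupation N w, S N w)) @^-1` C.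
  apply/seteqP; split => w /=.
    move=> [Yy /andP[Jt tJ] Bw]; split.
      by move=> j jN; split; [exact: Yy|rewrite leqNgt ltnS jN].
    by rewrite /C/= occupation_time; split => //; split=> //; move: tJ; rewrite big_ord_recr.
  move=> [H]; rewrite /C/= occupation_time => -[Jt [tJ Bw]]; split=> //.
    by move=> j jN; have [] := H j jN.
  by rewrite Jt big_ord_recr.
rewrite [X in Q X]setIC -integral_indic//; last first.
  by rewrite -[_ @^-1` _]setTI; exact: mOS.
pose G z := (\1_C z)%:E : \bar R.
have mG : measurable_fun setT G by apply/measurable_EFinP; exact: measurable_indic.
rewrite -[LHS]/(\int[Q]_(w in tails N.+1 (fun=> 0%R)) G (occupation N w, S N w)).
rewrite (law_step (leqnn N) (law_atP (leqnSn N)))//; last by move=> z; rewrite lee_fin.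
rewrite big_geq// mulr1.
transitivity (c%:E * Jops (fun=> 0%N) (steps_before N)
  (fun x => (expR (- t))%:E * final_hold h t B hpow 0 x) [tuple 0%R | _ < n]).
  congr (_ * Jops _ _ _ _); apply/funext => x.
  rewrite /damped /final_hold /hpow subr_ge0; have [xt|tx] := leP (total_time x) t; last first.
    rewrite mul0r mule0 integral0_eq ?mule0// => u _.
    by rewrite /G indicE memNset ?mul0e// => -[/=]; rewrite leNgt tx.
  rewrite expr0 fact0 divr1 mul1r indicE.
  have [Bx|Bx] := boolP (top_up h t x \in B); last first.
    rewrite mule0 integral0_eq ?mule0// => u _.
    rewrite /G indicE memNset ?mul0e// => -[/= _ [_]].
    by move/mem_set; rewrite (negPf Bx).
  rewrite mule1 (_ : \int[mu]_u _ = exp_law `](t - total_time x)%R, +oo[%classic).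
    rewrite exp_law_ray max_l ?subr_ge0// -EFinM -expRD; congr (expR _)%:E; ring.
  rewrite /exp_law [RHS]integral_mkcond; apply: eq_integral => u _.
  rewrite patchE mem_setE in_itv/= andbT ltrBlDl /G indicE.
  have [tu|tu] := boolP (t < total_time x + u)%R.
    by rewrite mem_set ?mul1e//; split => //; split=> //; exact: set_mem.
  by rewrite memNset ?mul0e// => -[/= _ []]; rewrite (negPf tu).
rewrite Jops_scale ?expR_ge0//.
- by rewrite EFinM muleA.
- by apply: measurable_final_hold => //; exact: measurable_hpow.
- by apply: final_hold_ge0; exact: hpow_ge0.
Qed.

End holding_times.

(** * The Dirichlet environment *)

Section environment.
Context {R : realType} (V : choiceType) (nbrs : V -> {fset V}).
Context dE (E : measurableType dE) (P : probability E R) (Delta : nat).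
Variable omega : E -> V -> V -> R.
Hypothesis Delta_gt0 : (0 < Delta)%N.
Hypothesis G_regular : regular_graph nbrs Delta.
Hypothesis omegaD : dirichlet_environment nbrs P Delta omega.
Local Open Scope ereal_scope.

Definition env i (e : E) : #|{: nbrs i}|.-tuple R :=
  vec (fun j : nbrs i => omega e i (val j)).

Lemma measurable_env i : measurable_fun setT (env i).
Proof. by have [+ _ _] := omegaD; exact. Qed.

Lemma env_law i (h : nbrs i) A : measurable A -> P (env i @^-1` A) =
  \int[simplex_measure (enum_rank h) 1%R]_(x in A) (Gamma (Delta%:R : R))%:E.
Proof. by have [_ + _] := omegaD; apply. Qed.

Lemma card_nbrs i : #|{: nbrs i}| = Delta.
Proof. by rewrite -cardfE G_regular. Qed.

Lemma nbrs_inhabited i : exists h : nbrs i, True.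
Proof.
have : (0 < #|{: nbrs i}|)%N by rewrite card_nbrs.
by move/card_gt0P => [h _]; exists h.
Qed.

(** Independence is given for events, so the functions are traded for indicators one vertex at a
    time. *)
Lemma env_independent (f : forall i, #|{: nbrs i}|.-tuple R -> R) (m : V -> R) (F : {fset V}) :
  (forall i, measurable_fun setT (f i)) -> (forall i x, (0 <= f i x)%R) ->
  (forall i, \int[P]_e (f i (env i e))%:E = (m i)%:E) ->
  \int[P]_e (\prod_(i <- F) f i (env i e))%:E = (\prod_(i <- F) m i)%:E.
Proof.
move=> mf f0 fm.
have [_ _ indep] := omegaD.
have m0 i : (0 <= m i)%R.
  by rewrite -lee_fin -fm; apply: integral_ge0 => e _; rewrite lee_fin.
(* Vertices of [s1] still carry their function, those of [s2] an indicator. With [s1] empty this is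
   the independence of events, with [s2] empty the goal. *)
suff claim s1 s2 (B : forall i, set (#|{: nbrs i}|.-tuple R)) :
    perm_eq (s1 ++ s2) F -> (forall i, measurable (B i)) ->
    \int[P]_e (\prod_(i <- s1) f i (env i e) * \prod_(i <- s2) \1_(B i) (env i e))%:E =
    (\prod_(i <- s1) m i)%:E * \prod_(i <- s2) P (env i @^-1` B i).
  have := claim F [::] (fun=> setT).
  rewrite cats0 perm_refl => /(_ isT (fun=> measurableT)).
  by rewrite big_nil mule1 => <-; apply: eq_integral => e _; rewrite big_nil mulr1.
have mpre i A : measurable A -> measurable (env i @^-1` A).
  by move=> mA; rewrite -[_ @^-1` _]setTI; exact: measurable_env.
elim: s1 s2 B => [|i s1 IH] s2 B.
  move=> /= s2F mB; rewrite big_nil mul1e.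
  rewrite (perm_big _ s2F) -indep//=.
  pose A := [set e | forall i, i \in F -> B i (env i e)].
  have AE : A = \bigcap_(i in [set` F]) (env i @^-1` B i) by [].
  rewrite -[X in P X]/A -[A]setIT -integral_indic//; last first.
    by rewrite AE; apply: fin_bigcap_measurable => // i _; exact: mpre.
  apply: eq_integral => e _; rewrite big_nil mul1r (perm_big _ s2F)/= indicE.
  have [/set_mem Ae|nAe] := boolP (e \in A).
    by rewrite big_seq big1// => i iF; rewrite indicE mem_set//; exact: Ae.
  have [i [iF nBi]] : exists i, i \in F /\ ~ B i (env i e).
    apply: contrapT => H; move/negP: nAe; apply; apply/mem_set => i iF.
    by apply: contrapT => nBi; apply: H; exists i.
  by rewrite (big_rem i)//= indicE memNset ?mul0r.
move=> /= sF mB.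
have is2 : i \notin s2.
  have : uniq (i :: s1 ++ s2) by rewrite (perm_uniq sF) fset_uniq.
  by rewrite /= mem_cat negb_or => /andP[/andP[]].
pose h e := (\prod_(i <- s1) f i (env i e) * \prod_(i <- s2) \1_(B i) (env i e))%R.
pose c := (\prod_(i <- s1) m i * \prod_(i <- s2) fine (P (env i @^-1` B i)))%R.
have cE : (\prod_(i <- s1) m i)%:E * \prod_(i <- s2) P (env i @^-1` B i) = c%:E.
  rewrite /c EFinM; congr (_ * _); elim: (s2) => [|j s IHs]; rewrite ?big_nil// !big_cons EFinM -IHs.
  by rewrite fineK// fin_num_measure//; exact: mpre.
have c0 : (0 <= c)%R.
  by rewrite mulr_ge0// prodr_ge0// => j _; rewrite fine_ge0.
have mh : measurable_fun setT h.
  apply: measurable_funM; apply: measurable_prod => j _ /=.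
    exact: (measurableT_comp (mf j) (@measurable_env j)).
  have mi : measurable_fun setT (\1_(B j) : _ -> R).
    by apply: measurable_indic; exact: mB.
  exact: (measurableT_comp mi (@measurable_env j)).
have h0 e : (0 <= h e)%R.
  by rewrite mulr_ge0// prodr_ge0.
move: c cE c0 => c cE c0.
transitivity (\int[P]_e ((f i (env i e))%:E * c%:E)); last first.
  rewrite ge0_integralZr//.
  - by rewrite fm big_cons EFinM -muleA cE.
  - by apply/measurable_EFinP; exact: (measurableT_comp (mf i) (@measurable_env i)).
  - by move=> e _; rewrite lee_fin.
transitivity (\int[P]_e ((f i (env i e))%:E * (h e)%:E)).
  by apply: eq_integral => e _; rewrite big_cons -EFinM mulrA.
rewrite -[RHS]/(\int[P]_e ((EFin \o f i) (env i e) * (cst c e)%:E)).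
apply: (eq_integral_indic (@measurable_env i) (@measurable_env i) mh (measurable_cst c)
   h0 (fun=> c0) _ (f := EFin \o f i)); last 2 first.
- by apply/measurable_EFinP; exact: mf.
- by move=> x; rewrite lee_fin.
move=> A mA.
rewrite -[RHS]/(\int[P]_e ((\1_A (env i e))%:E * c%:E)).
(* As [i] is not in [s2], changing its set to [A] leaves the other indicators alone. *)
pose B' : forall j, set (#|{: nbrs j}|.-tuple R) :=
  @dfwith V (fun j => set (#|{: nbrs j}|.-tuple R)) B i A.
have B'2 : \prod_(j <- s2) P (env j @^-1` B' j) = \prod_(j <- s2) P (env j @^-1` B j).
  rewrite big_seq [RHS]big_seq; apply: eq_bigr => j js2.
  by rewrite /B' dfwithout//; apply: contraNneq is2 => ->.
transitivity (\int[P]_e (\prod_(i <- s1) f i (env i e) *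
    \prod_(i <- i :: s2) \1_(B' i) (env i e))%:E).
  apply: eq_integral => e _; rewrite big_cons /B' dfwithin mulrCA EFinM; congr (_ * (_ * _)%:E).
  rewrite big_seq [RHS]big_seq; apply: eq_bigr => j js2.
  by rewrite dfwithout//; apply: contraNneq is2 => ->.
rewrite IH; last 2 first.
- by rewrite (perm_trans _ sF)// perm_catC/= perm_cons perm_catC.
- move=> j; rewrite /B'; have [<-|ij] := eqVneq i j; first by rewrite dfwithin.
  by rewrite dfwithout.
rewrite big_cons B'2 muleCA cE /B' dfwithin ge0_integralZr//.
- rewrite (_ : (fun e => _) = EFin \o \1_(env i @^-1` A))//.
  by rewrite integral_indic ?setIT//; exact: mpre.
- have mi : measurable_fun setT (\1_A : _ -> R) by exact: measurable_indic.
  by apply/measurable_EFinP; exact: (measurableT_comp mi (@measurable_env i)).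
Qed.

Lemma big_nbrs (T : Type) (idx : T) (op : Monoid.com_law idx) i (f : V -> T) :
  \big[op/idx]_(j <- nbrs i) f j =
  \big[op/idx]_(a < #|{: nbrs i}|) f (val (enum_val a)).
Proof. by rewrite big_seq_fsetE/= -(big_enum_val (fun j : nbrs i => f (val j))). Qed.

Lemma omega_positive i : {ae P, forall e, env i e \in positive_orthant R _}.
Proof.
have [h _] := nbrs_inhabited i.
pose O := ~` positive_orthant R #|{: nbrs i}|.
have mO : measurable O by apply: measurableC; exact: measurable_positive_orthant.
exists (env i @^-1` O); split.
- by rewrite -[_ @^-1` _]setTI; exact: measurable_env.
- rewrite (env_law h)// integral_cst//= /simplex_measure /mrestr /= setICl.
  by rewrite /pushforward preimage_set0 measure0 mule0.
- by move=> e /= /negP; rewrite notin_setE.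
Qed.

Lemma exit_rate1 i : {ae P, forall e, exit_rate nbrs (omega e) i = 1%R}.
Proof.
have [h _] := nbrs_inhabited i.
pose O : set (#|{: nbrs i}|.-tuple R) := (@total_time R _) @^-1` (~` [set 1%R]).
have mO : measurable O.
  rewrite /O -[X in measurable X]setTI; apply: measurable_total_time => //.
  exact: measurableC.
exists (env i @^-1` O); split.
- by rewrite -[_ @^-1` _]setTI; exact: measurable_env.
- rewrite (env_law h)// integral_cst//= /simplex_measure /mrestr /= /pushforward.
  rewrite (_ : _ @^-1` _ = set0) ?measure0 ?mule0//.
  apply/seteqP; split => // x [/= ox _]; apply: ox.
  rewrite /total_time (bigD1 (enum_rank h))//= tnth_mktuple unlift_none.
  rewrite (reindex_omap (lift (enum_rank h)) (unlift (enum_rank h))) => [|i' ih]; last first.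
    by case: unliftP ih => [j ->|->]; rewrite ?eqxx.
  rewrite [X in (_ + X)%R](_ : _ = \sum_j tnth x j)%R ?subrK//.
  apply: congr_big => // [j|j _]; first by rewrite liftK eqxx eq_sym neq_lift.
  by rewrite tnth_mktuple liftK.
- move=> e /= ne; apply: contra_not ne => /= <-.
  rewrite /exit_rate big_nbrs; apply: eq_bigr => a _.
  by rewrite tnth_mktuple.
Qed.

(** The indicator makes the monomial nonnegative everywhere; on the environment it is almost surely
    1. *)
Definition monomial n (k : 'I_n -> nat) (x : n.-tuple R) : R :=
  (\prod_a tnth x a ^+ k a * \1_(positive_orthant R n) x)%R.

Lemma monomial_ge0 n (k : 'I_n -> nat) x : (0 <= monomial k x)%R.
Proof.
rewrite /monomial indicE; have [/set_mem x0|] := boolP (x \in _); last by rewrite mulr0.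
by rewrite mulr1 prodr_ge0// => a _; rewrite exprn_ge0// ltW.
Qed.

Lemma measurable_monomial n (k : 'I_n -> nat) : measurable_fun setT (monomial k).
Proof.
apply: measurable_funM.
  apply: measurable_prod => a _; apply: measurable_funX; exact: measurable_tnth.
by apply: measurable_indic; exact: measurable_positive_orthant.
Qed.

(** Once each power is divided by its factorial, the Dirichlet integral at t = 1 is the inverse
    factorial of the sum of the exponents plus [Delta.-1], that is, the Gamma value in the
    denominator. *)
Lemma dirichlet_moment i (k : 'I_#|{: nbrs i}| -> nat) :
  \int[P]_e (monomial k (env i e))%:E =
  (Gamma (Delta%:R : R) * (\prod_a (k a)`!%:R) / Gamma ((\sum_a k a + Delta)%:R : R))%:E.
Proof.
have [h _] := nbrs_inhabited i.
pose nu := simplex_measure (enum_rank h) (1%R : R).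
have G0 : (0 <= Gamma (Delta%:R : R))%R by rewrite -(prednK Delta_gt0) Gamma_nat.
have indE A : measurable A ->
    \int[P]_e ((\1_A (env i e))%:E * (cst 1%R e : R)%:E) =
    \int[nu]_x ((\1_A x)%:E * (cst (Gamma (Delta%:R : R)) x : R)%:E).
  move=> mA; under eq_integral do rewrite mule1.
  rewrite (_ : (fun e => _) = EFin \o \1_(env i @^-1` A))//.
  rewrite integral_indic ?setIT//; last first.
    by rewrite -[_ @^-1` _]setTI; exact: measurable_env.
  rewrite [LHS](env_law h mA) integral_mkcond; apply: eq_integral => x _.
  by rewrite patchE indicE; case: ifP => _; rewrite ?mul1e ?mul0e.
transitivity (\int[P]_e ((monomial k (env i e))%:E * (cst 1%R e : R)%:E)).
  by under [RHS]eq_integral do rewrite mule1.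
have mmk : measurable_fun setT (EFin \o monomial k).
  by apply/measurable_EFinP; exact: measurable_monomial.
have mk0 x : 0 <= (EFin \o monomial k) x by rewrite lee_fin monomial_ge0.
have := eq_integral_indic (@measurable_env i) (@measurable_id _ _ setT)
  (measurable_cst (1%R : R)) (measurable_cst (Gamma (Delta%:R : R)))
  (fun=> ler01) (fun=> G0) indE mmk mk0.
move=> ->; rewrite -[LHS]/(\int[nu]_x ((monomial k x)%:E * (Gamma (Delta%:R : R))%:E)).
rewrite ge0_integralZr//; last by move=> x _; exact: mk0.
transitivity (\int[nu]_(l in positive_orthant R _)
    ((\prod_a (k a)`!%:R)%:E * (\prod_a (tnth l a ^+ k a / (k a)`!%:R))%:E) *
    (Gamma (Delta%:R : R))%:E).
  congr (_ * _); rewrite [RHS]integral_mkcond; apply: eq_integral => l _.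
  rewrite patchE /= /monomial indicE; case: ifP => _; last by rewrite mulr0.
  rewrite mulr1 -EFinM -big_split/=; congr (_%:E); apply: eq_bigr => a _.
  by rewrite mulrCA divff ?mulr1// pnatr_eq0 -lt0n fact_gt0.
have mprod : measurable_fun setT
    (fun l : #|{: nbrs i}|.-tuple R => \prod_a (tnth l a ^+ k a / (k a)`!%:R))%R.
  apply: measurable_prod => a _; apply: measurable_funM => //.
  by apply: measurable_funX; exact: measurable_tnth.
rewrite ge0_integralZl_EFin//; last 4 first.
- exact: measurable_positive_orthant.
- move=> l l0; rewrite lee_fin prodr_ge0// => a _.
  by rewrite divr_ge0// exprn_ge0// ltW.
- by apply/measurable_EFinP; exact: measurable_funTS.
- by rewrite prodr_ge0.
have cE : (#|{: nbrs i}|.-1 = Delta.-1)%N by rewrite card_nbrs.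
rewrite dirichlet_integral// expr1n cE -!EFinM; congr EFin.
have -> : (\sum_a k a + Delta)%N = (\sum_a k a + Delta.-1).+1.
  by rewrite -addnS prednK.
by rewrite Gamma_nat; ring.
Qed.

End environment.

(** * Step paths and the quenched law *)

Section step_paths.
Context {R : realType} (V : choiceType) (W : Type).
Variables (nbrs : V -> {fset V}) (Y : nat -> W -> V) (S : nat -> W -> R) (X : R -> W -> V) (w : W).
Hypothesis S_gt0 : forall n, 0 < S n w.
Hypothesis J_unbounded : forall s, exists n, s < jump_time S n w.
Hypothesis XE : forall n s,
  jump_time S n w <= s < jump_time S n.+1 w -> X s w = Y n w.
Local Notation J n := (jump_time S n w).

Lemma jump_timeS n : J n.+1 = J n + S n w.
Proof. by rewrite /jump_time big_ord_recr. Qed.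

Lemma jump_time0 : J 0 = 0.
Proof. by rewrite /jump_time big_ord0. Qed.

Lemma jump_time_lt m n : (m < n)%N -> J m < J n.
Proof.
elim: n => // n IH; rewrite ltnS leq_eqVlt => /predU1P[->|/IH mn].
  by rewrite jump_timeS ltrDl.
by rewrite (lt_trans mn)// jump_timeS ltrDl.
Qed.

Lemma jump_time_le m n : (m <= n)%N -> J m <= J n.
Proof. by rewrite leq_eqVlt => /predU1P[->//|/jump_time_lt/ltW]. Qed.

Lemma jump_interval s : 0 <= s -> exists n, J n <= s < J n.+1.
Proof.
move=> s0; have [/= [|n]] := ex_minnP (J_unbounded s).
  by rewrite jump_time0 ltNge s0.
move=> sn min_n; exists n; rewrite sn andbT leNgt; apply/negP => /min_n.
by rewrite ltnn.
Qed.

Lemma jump_interval_le m n s t : J m <= s -> s <= t -> t < J n.+1 -> (m <= n)%N.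
Proof.
move=> ms st tn; rewrite leqNgt; apply/negP => /jump_time_le nm.
by have := le_lt_trans (le_trans nm (le_trans ms st)) tn; rewrite ltxx.
Qed.

Lemma near_left_const a b s i : a < s -> (forall r, a < r -> r < s -> X r w = b) ->
  (\forall r \near s^'-, X r w = i) <-> b = i.
Proof.
move=> as_ H; have Xb : \forall r \near s^'-, X r w = b.
  have ar : \forall r \near s^'-, a < r by exact: nbhs_left_gt.
  have rs : \forall r \near s^'-, r < s by exact: nbhs_left_lt.
  near=> r; apply: H.
    by near: r; exact: ar.
  by near: r; exact: rs.
split=> [Xi|<-//].
have XX : \forall r \near s^'-, X r w = b /\ X r w = i.
  near=> r; split.
    by near: r.
  by near: r.
have [r Xr] := @filter_ex _ (s^'-) (at_left_proper_filter s) _ XX; by case: Xr => <- <-.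
Unshelve. all: by end_near. Qed.

Variables (t : R) (N : nat).
Hypothesis JN : J N <= t < J N.+1.

Definition crossings i j := [seq m <- iota 0 N | (Y m w == i) && (Y m.+1 w == j)].

(** A jump must occur at some J_{n+1}: inside a holding interval the left limit and the value agree,
    which [i != j] excludes. *)
Lemma jumpsE i j : i != j ->
  jumps X t w i j = (fun p => J (nth 0%N (crossings i j) p).+1) @` `I_(size (crossings i j)).
Proof.
move=> ij; apply/seteqP; split => s /=.
  move=> [s0 st Xi Xj].
  have [n /andP[ns sn]] := jump_interval (ltW s0).
  have Yj : Y n w = j by rewrite -(XE (n := n) (s := s)) ?ns.
  move: ns; rewrite le_eqVlt => /predU1P[ns|ns]; last first.
    have /near_left_const : forall r, J n < r -> r < s -> X r w = Y n w.
      by move=> r nr rs; apply: XE; rewrite (ltW nr) (lt_trans rs).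
    move=> /(_ i ns)[/(_ Xi) Yi _].
    by move: ij; rewrite -Yi Yj eqxx.
  case: n ns sn Yj => [|n] ns sn Yj; first by move: s0; rewrite -ns jump_time0 ltxx.
  have Yi : Y n w = i.
    have ns' : J n < s by rewrite -ns jump_time_lt.
    apply/(near_left_const _ ns'); last exact: Xi.
    by move=> r nr rs; apply: XE; rewrite (ltW nr) ns.
  have nN : (n < N)%N.
    by apply: (@jump_interval_le n.+1 N s t) => //; [rewrite ns|case/andP: JN].
  have nc : n \in crossings i j.
    by rewrite mem_filter Yi Yj !eqxx mem_iota.
  by exists (index n (crossings i j)); rewrite ?index_mem// nth_index.
move=> [p pc <-]; set m := nth _ _ _.
have : m \in crossings i j by exact: mem_nth.
rewrite mem_filter mem_iota add0n => /andP[/andP[/eqP Yi /eqP Yj] /= mN].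
have mS : J m < J m.+1 by exact: jump_time_lt.
split.
- by rewrite (le_lt_trans _ mS)// -jump_time0 jump_time_le.
- by rewrite (le_trans (jump_time_le mN))//; case/andP: JN.
- apply/(near_left_const _ mS); last exact: Yi.
  by move=> r nr rs; apply: XE; rewrite (ltW nr).
- by rewrite -Yj; apply: XE; rewrite lexx jump_time_lt.
Qed.

Lemma jumps_card i j c : i != j ->
  (jumps X t w i j #= `I_c)%card <-> size (crossings i j) = c.
Proof.
move=> ij; rewrite jumpsE// (card_eql (inj_card_eq _)).
  by split => /card_eq_II.
move=> p q; rewrite !inE /= => pc qc /eqP.
have key a b : J a = J b -> a = b.
  by have [/jump_time_lt/[swap]->|/jump_time_lt/[swap]->|//] := ltngtP a b; rewrite ltxx.
move=> /eqP/key [] /eqP; rewrite nth_uniq//; first by move/eqP.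
by rewrite filter_uniq// iota_uniq.
Qed.

Local Open Scope ereal_scope.
Lemma local_timeE i : local_time X t w i =
  (\sum_(m < N) (Y m w == i)%:R * S m w + (Y N w == i)%:R * (t - J N))%R.
Proof.
have /andP[JNt tJN] := JN.
rewrite /local_time /Rintegral.
(* Each s in [0, t] lies in exactly one of the half-open holding intervals 0, ..., N; the last one
   is cut off at t. *)
transitivity (fine (\sum_(m < N.+1) \int[lebesgue_measure]_(s in `[0%R, t])
   ((Y m w == i)%:R * \1_`[J m, J m.+1[%classic s)%:E)).
  congr fine; rewrite -ge0_integral_sum//; last first.
    by move=> m; apply/measurable_EFinP; apply: measurable_funM.
  apply: eq_integral => s; rewrite inE/= in_itv/= => /andP[s0 st].
  rewrite sumEFin; congr EFin.
  have [n /andP[ns sn]] := jump_interval s0.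
  have nN : (n < N.+1)%N by rewrite ltnS; exact: (jump_interval_le ns st tJN).
  rewrite (XE (n := n)) ?ns// (bigD1 (Ordinal nN))//= indicE mem_set ?mulr1; last first.
    by rewrite /= in_itv/= ns.
  rewrite big1 ?addr0// => m mn.
  rewrite indicE memNset ?mulr0//= in_itv/= => /andP[ms sm].
  move/eqP: mn; apply; apply: val_inj => /=; apply/eqP; rewrite eqn_leq.
  by rewrite (jump_interval_le ms (lexx s) sn) (jump_interval_le ns (lexx s) sm).
have term (m : nat) : \int[lebesgue_measure]_(s in `[0%R, t])
   ((Y m w == i)%:R * \1_`[J m, J m.+1[%classic s)%:E =
   (Y m w == i)%:R%:E * lebesgue_measure (`[J m, J m.+1[%classic `&` `[0%R, t]%classic).
  rewrite -integral_indic// -ge0_integralZl_EFin//.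
  by apply/measurable_EFinP; exact: measurable_indic.
have J0 m : (0 <= J m)%R by rewrite -jump_time0 jump_time_le.
rewrite big_ord_recr/= term.
rewrite (_ : `[J N, J N.+1[%classic `&` _ = `[J N, t]%classic); last first.
  apply/seteqP; split=> s /=; rewrite !in_itv/=.
    by move=> [/andP[-> _] /andP[_ ->]].
  by move=> /andP[Ns st]; rewrite Ns st (le_trans (J0 N) Ns) (le_lt_trans st tJN).
rewrite lebesgue_measure_itv/= lte_fin.
rewrite (_ : (if (J N < t)%R then _ else _) = (t - J N)%:E); last first.
  case: ifPn => //; rewrite -leNgt => tJ.
  by have -> : t = J N by [apply/eqP; rewrite eq_le tJ]; rewrite subrr.
rewrite (eq_bigr (fun m : 'I_N => ((Y m w == i)%:R * S m w)%:E)).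
  by rewrite sumEFin -EFinM -EFinD.
move=> m _; rewrite term EFinM; congr (_ * _).
rewrite setIidl; last first.
  move=> s /=; rewrite !in_itv/= => /andP[ms sm].
  rewrite (le_trans (J0 m) ms)/= (le_trans (ltW sm))//.
  by rewrite (le_trans (jump_time_le _) JNt).
by rewrite lebesgue_measure_itv/= lte_fin jump_time_lt// -EFinB jump_timeS addrAC subrr add0r.
Qed.

End step_paths.

(** Balls around [o] are finite and exhaust the graph. The injection codes finite paths, so that
    countably many cylinders cover the sample space. *)
Lemma connected_countable (V : choiceType) (nbrs : V -> {fset V}) (o : V) :
  connected_on predT (graph_rel nbrs) -> exists f : V -> nat, injective f.
Proof.
move=> conn.
pose ball n : set V := iter n (fun A => \bigcup_(i in A) [set` nbrs i]) [set o].
have finball n : finite_set (ball n).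
  elim: n => [|n IH] /=; first exact: finite_set1.
  by apply: bigcup_finite => // i _; exact: finite_fset.
have cover : [set: V] = \bigcup_n ball n.
  apply/esym; rewrite -subTset => v _.
  have [p pp <-] := conn o v isT isT; exists (size p) => //.
  elim/last_ind: p pp {v} => [|p x IH]; first by [].
  rewrite rcons_path last_rcons size_rcons => /andP[/IH pl px].
  by exists (last o p).
have : countable [set: V].
  by rewrite cover; apply: bigcup_countable => // n _; exact: finite_set_countable.
by move/countable_injP => [f finj]; exists f => x y; apply: finj; rewrite in_setT.
Qed.

(** * The event as a countable union of path cylinders *)

Section quenched_event.
Context {R : realType} (V : choiceType) d (W : measurableType d).
Variables (nbrs : V -> {fset V}) (Y : nat -> W -> V) (S : nat -> W -> R) (X : R -> W -> V).
Hypothesis G_simple : simple_graph nbrs.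
Hypothesis mY : forall n v, measurable (Y n @^-1` [set v]).
Hypothesis mS : forall n, measurable_fun setT (S n).
Hypothesis S_gt0 : forall n w, 0 < S n w.
Hypothesis J_unbounded : forall w s, exists n, s < jump_time S n w.
Hypothesis XE : forall n w s,
  jump_time S n w <= s < jump_time S n.+1 w -> X s w = Y n w.
Variables (code : V -> nat).
Hypothesis code_inj : injective code.
Variables (V' : {fset V}) (r : V) (t : R) (k : V -> V -> nat) (B : set (#|{: V'}|.-tuple R)).
Hypothesis t_ge0 : 0 <= t.
Hypothesis mB : measurable B.
Local Notation J n w := (jump_time S n w).

Definition walk_event : set W :=
  [set w | [/\ jump_counts_eq nbrs X t w k,
               B (vec (fun i : V' => local_time X t w (val i)))
             & X t w = r]].

Definition cylinder (y : nat -> V) N : set W :=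
  [set w | (forall j, (j <= N)%N -> Y j w = y j) /\ J N w <= t < J N.+1 w].

Definition path_steps (y : nat -> V) N i j :=
  size [seq m <- iota 0 N | (y m == i) && (y m.+1 == j)].

Definition admissible (y : nat -> V) N :=
  (forall i j, j \in nbrs i -> path_steps y N i j = k i j) /\ y N = r.

Definition holding_vec (y : nat -> V) N w : #|{: V'}|.-tuple R :=
  [tuple \sum_(m < N) (y m == val (enum_val a))%:R * S m w +
     (y N == val (enum_val a))%:R * (t - J N w) | a < #|{: V'}|].

(** On a cylinder the counts and the endpoint are determined by [y]; only the local times remain
    random. *)
Lemma walk_event_cylinder y N w : cylinder y N w ->
  walk_event w <-> admissible y N /\ B (holding_vec y N w).
Proof.
move=> [Yy JN].
have XtE : X t w = y N by rewrite (XE JN) Yy.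
have cE i j : crossings Y w N i j = [seq m <- iota 0 N | (y m == i) && (y m.+1 == j)].
  apply: eq_in_filter => m; rewrite mem_iota add0n => /andP[_ mN].
  by rewrite !Yy// ltnW.
have vE : vec (fun i : V' => local_time X t w (val i)) = holding_vec y N w.
  apply: eq_from_tnth => a; rewrite !tnth_mktuple.
  rewrite (local_timeE (S_gt0^~ w) (J_unbounded w) (XE^~ w) JN) Yy//.
  by congr (_ + _); apply: eq_bigr => m _; rewrite Yy// ltnW.
have cntE i j : j \in nbrs i ->
    (jumps X t w i j #= `I_(k i j))%card <-> path_steps y N i j = k i j.
  move=> ij; rewrite (jumps_card (S_gt0^~ w) (J_unbounded w) (XE^~ w) JN) ?cE//.
  by apply: contraTneq ij => ->; have [/(_ j)] := G_simple.
rewrite /walk_event /admissible /= vE XtE; split.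
  by move=> [H Bv yr]; split=> //; split=> // i j ij; apply/cntE => //; exact: H.
by move=> [[H yr] Bv]; split=> // i j ij; apply/cntE => //; exact: H.
Qed.

Lemma measurable_holding_vec y N : measurable_fun setT (holding_vec y N).
Proof.
apply/measurable_fun_tnthP => a.
rewrite (_ : _ \o _ = fun w => \sum_(m < N) (y m == val (enum_val a))%:R * S m w +
     (y N == val (enum_val a))%:R * (t - J N w)); last first.
  by apply/funext => w /=; rewrite tnth_mktuple.
apply: measurable_funD.
  by apply: measurable_sum => m; apply: measurable_funM.
apply: measurable_funM => //; apply: measurable_funB => //.
exact: measurable_sum.
Qed.

Lemma measurable_cylinder y N : measurable (cylinder y N).
Proof.
have mJ n : measurable_fun setT (jump_time S n) by exact: measurable_sum.
rewrite (_ : cylinder y N = (\bigcap_(j < N.+1) (Y j @^-1` [set y j])) `&`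
  (jump_time S N @^-1` `]-oo, t] `&` jump_time S N.+1 @^-1` `]t, +oo[)).
  apply: measurableI; first exact: bigcap_measurableType.
  by apply: measurableI; rewrite -[X in measurable X]setTI; exact: mJ.
apply/seteqP; split => w /=; rewrite !in_itv/= andbT.
  by move=> [H /andP[]].
by move=> [H [Jt tJ]]; split=> //; apply/andP.
Qed.

Lemma measurable_walk_event_cylinder y N : measurable (walk_event `&` cylinder y N).
Proof.
have [ady|nad] := pselect (admissible y N).
  rewrite (_ : _ `&` _ = cylinder y N `&` holding_vec y N @^-1` B).
    apply: measurableI; first exact: measurable_cylinder.
    by rewrite -[_ @^-1` _]setTI; exact: measurable_holding_vec.
  apply/seteqP; split => w [].
    by move=> Aw cw; split=> //; have /walk_event_cylinder[/(_ Aw)[]] := cw.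
  by move=> cw Bw; split=> //; apply/(walk_event_cylinder cw).
rewrite (_ : _ `&` _ = set0)//; apply/seteqP; split => // w [Aw cw].
by have /walk_event_cylinder[/(_ Aw)[]] := cw.
Qed.

(** [c] lists the codes of all vertices visited up to time t, start included, so its size is one
    more than the number of jumps. Unlike the functions [y], such lists are countably many. *)
Definition code_cylinder (c : seq nat) : set W :=
  [set w | J (size c).-1 w <= t < J (size c) w /\
     forall m, (m < size c)%N -> code (Y m w) = nth 0%N c m].

Lemma code_cylinderP c w0 : code_cylinder c w0 ->
  code_cylinder c = cylinder (fun m => Y m w0) (size c).-1.
Proof.
move=> [J0 c0].
(* An empty list would require J_0 <= t < J_0. *)
have sc : size c = (size c).-1.+1.
  case: c J0 {c0} => //=; rewrite /jump_time !big_ord0 => /andP[t0 t0'].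
  by have := le_lt_trans t0 t0'; rewrite ltxx.
apply/seteqP; split => w /=.
  move=> [Jw cw]; split; last by rewrite -sc.
  by move=> j; rewrite -ltnS -sc => jc; apply: code_inj; rewrite cw// c0.
move=> [Yw Jw]; split; first by move: Jw; rewrite -sc.
by move=> m mc; rewrite Yw ?c0// -ltnS -sc.
Qed.

Lemma code_cylinder_cover : [set: W] = \bigcup_c code_cylinder c.
Proof.
apply/esym; rewrite -subTset => w _.
have [N JN] := jump_interval (J_unbounded w) t_ge0.
exists [seq code (Y m w) | m <- iota 0 N.+1] => //.
split; first by rewrite size_map size_iota.
by move=> m; rewrite size_map size_iota => mN; rewrite (nth_map 0%N) ?size_iota// nth_iota.
Qed.

Lemma measurable_walk_event : measurable walk_event.
Proof.
rewrite -[walk_event]setIT code_cylinder_cover setI_bigcupr.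
apply: countable_bigcupT_measurable => [|c]; first exact: countableP.
have [[w0 c0]|c0] := pselect (exists w0, code_cylinder c w0).
  by rewrite (code_cylinderP c0); exact: measurable_walk_event_cylinder.
rewrite (_ : _ `&` _ = set0)//; apply/seteqP; split => // w [_ cw].
by apply: c0; exists w.
Qed.

(** Outside [D] the event is covered by countably many admissible cylinders not contained in [D],
    each of them null. *)
Lemma walk_event_restrict (Q : {measure set W -> \bar R}) (D : set W) :
  measurable D ->
  (forall y N, admissible y N -> ~ cylinder y N `<=` D ->
    Q (cylinder y N) = 0%E) ->
  Q walk_event = Q (walk_event `&` D).
Proof.
move=> mD H; have mA := measurable_walk_event.
have -> : Q walk_event = (Q (walk_event `&` D) + Q (walk_event `\` D))%E.
  rewrite -measureU; first by rewrite setUIDK.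
  - exact: measurableI.
  - exact: measurableD.
  - by rewrite setDE setIACA setICr setI0.
rewrite [X in (_ + X)%E](_ : _ = 0%E) ?adde0//.
apply: measure_negligible; first exact: measurableD.
pose F n := if (choice.unpickle n : option (seq nat)) is Some c then (walk_event `&` code_cylinder c) `\` D else set0.
apply: (@negligibleS _ _ _ _ (\bigcup_n F n)).
  move=> w [Aw nDw]; have [c _ cw] : (\bigcup_c code_cylinder c) w.
    by rewrite -code_cylinder_cover.
  by exists (choice.pickle c) => //; rewrite /F choice.pickleK.
apply: negligible_bigcup => n; rewrite /F.
case: (choice.unpickle n : option (seq nat)) => [c|]; last exact: negligible_set0.
have [[w [[Aw cw] nDw]]|nw] := pselect (exists w, ((walk_event `&` code_cylinder c) `\` D) w); last first.
  rewrite (_ : _ `\` _ = set0); first exact: negligible_set0.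
  by apply/seteqP; split => // w Hw; apply: nw; exists w.
have cE := code_cylinderP cw; set y := fun m => _ in cE.
have cyw : cylinder y (size c).-1 w by rewrite -cE.
apply: (@negligibleS _ _ _ _ (cylinder y (size c).-1)).
  by move=> w' [[_]]; rewrite cE.
apply/negligibleP; first exact: measurable_cylinder.
apply: H; first by have /walk_event_cylinder[/(_ Aw)[]] := cyw.
by move=> /(_ _ cyw).
Qed.

End quenched_event.

(** * Trails and their step counts *)

Section trails_paths.
Variables (I : finType) (o r : I) (N : nat) (k : I -> I -> nat) (z : N.-tuple I).

Lemma zip_steps :
  zip (o :: z) z = [seq (nth o (o :: z) m, nth o (o :: z) m.+1) | m <- iota 0 N].
Proof.
apply: (@eq_from_nth _ (o, o)).
  by rewrite size_map size_iota size_zip /= size_tuple; apply/minn_idPr.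
move=> m; rewrite size_zip /= size_tuple => mN'; have mN : (m < N)%N by lia.
by rewrite (nth_map 0%N) ?size_iota// nth_iota// add0n nth_zip_cond/= size_zip /= size_tuple mN'.
Qed.

Lemma steps_count i j : steps o z i j =
  count (fun m => (nth o (o :: z) m == i) && (nth o (o :: z) m.+1 == j)) (iota 0 N).
Proof. by rewrite /steps zip_steps count_map; apply: eq_count => m /=; rewrite xpair_eqE. Qed.

Hypothesis zT : z \in trails N k o r.

Lemma trail_steps i j : steps o z i j = k i j.
Proof. by move: zT; rewrite inE => /andP[/forallP/(_ i)/forallP/(_ j)/eqP]. Qed.

Lemma trail_last : nth o (o :: z) N = r.
Proof.
move: zT; rewrite inE => /andP[_ /eqP <-].
by rewrite -[RHS](nth_last o (o :: z)) [size _]/= size_tuple.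
Qed.

(** The final position is left out, since no step starts there: only completed holds are counted. *)
Lemma trail_row i : count (fun m => nth o (o :: z) m == i) (iota 0 N) = row k i.
Proof.
rewrite /row -(eq_bigr _ (fun j _ => trail_steps i j)).
under eq_bigr do rewrite steps_count.
elim: (iota 0 N) => [|m s IH] /=; first by rewrite big1.
rewrite big_split/= -IH; congr addn; case: eqP => _ /=; last by rewrite big1.
by rewrite (bigD1 (nth o z m))//= eqxx big1// => j /negPf; rewrite eq_sym => ->.
Qed.

Lemma trail_prod (R : comPzSemiRingType) (q : I -> I -> R) :
  (\prod_(0 <= m < N) q (nth o (o :: z) m) (nth o (o :: z) m.+1) =
  \prod_i \prod_j q i j ^+ k i j)%R.
Proof.
transitivity (\prod_(p <- zip (o :: z) z) q p.1 p.2)%R.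
  by rewrite zip_steps big_map /index_iota subn0.
rewrite pair_bigA/=.
under [RHS]eq_bigr => p _ do rewrite -trail_steps /steps -surjective_pairing.
elim: (zip _ _) => [|p s IH]; first by rewrite big_nil big1.
rewrite big_cons IH (bigD1 p)//= [RHS](bigD1 p)//= eqxx exprS mulrA; congr (_ * _)%R.
by apply: eq_bigr => p' /negPf pp'; rewrite eq_sym pp'.
Qed.

End trails_paths.

(** * The quenched probability of the event *)

Section quenched_law.
Context {R : realType} (V : choiceType) d (W : measurableType d).
Variables (Q : {measure set W -> \bar R}) (q : V -> V -> R).
Variables (nbrs : V -> {fset V}) (Y : nat -> W -> V) (S : nat -> W -> R) (X : R -> W -> V).
Hypothesis Qoo : (Q setT < +oo)%E.
Hypothesis G_simple : simple_graph nbrs.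
Hypothesis mY : forall n v, measurable (Y n @^-1` [set v]).
Hypothesis mS : forall n, measurable_fun setT (S n).
Hypothesis S_gt0 : forall n w, 0 < S n w.
Hypothesis J_unbounded : forall w s, exists n, s < jump_time S n w.
Hypothesis XE : forall n w s,
  jump_time S n w <= s < jump_time S n.+1 w -> X s w = Y n w.
Variables (code : V -> nat).
Hypothesis code_inj : injective code.
Variables (V' : {fset V}) (E' : rel V) (o i1 : V') (t : R) (k : V -> V -> nat).
Variable B : set (#|{: V'}|.-tuple R).
Hypothesis QYS : forall n (y : nat -> V) (s : nat -> R), (forall m, 0 <= s m) ->
  Q [set w | forall m, (m <= n)%N -> Y m w = y m /\ s m < S m w] =
  ((y 0%N == val o)%:R * (\prod_(m < n) jump_prob nbrs q (y m) (y m.+1)) *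
   \prod_(m < n.+1) expR (- (exit_rate nbrs q (y m) * s m)))%:E.
Hypothesis rate1 : forall i : V', exit_rate nbrs q (val i) = 1.
Hypothesis t_ge0 : 0 <= t.
Hypothesis mB : measurable B.
Hypothesis G'_subgraph : subgraph nbrs V' E'.
Hypothesis k_supp : forall i j, ~~ E' i j -> k i j = 0%N.
Local Notation J n w := (jump_time S n w).

Definition fset_counts (i j : V') : nat := k (val i) (val j).
Local Notation kk := fset_counts.
Definition total_steps : nat := (\sum_i row kk i)%N.
Local Notation NN := total_steps.

Definition trail_path n (z : n.-tuple V') (m : nat) : V := val (nth o (o :: z) m).

Lemma path_steps_trail n (z : n.-tuple V') i j :
  path_steps (trail_path z) n (val i) (val j) = steps o z i j.
Proof. by rewrite steps_count -size_filter /path_steps. Qed.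

Lemma trail_admissible (z : NN.-tuple V') :
  z \in trails NN kk o i1 -> admissible nbrs (val i1) k (trail_path z) NN.
Proof.
move=> zT; split; last by rewrite /trail_path (trail_last zT).
move=> i j _; have [/andP[iV jV]|] := boolP ((i \in V') && (j \in V')).
  by rewrite -[i]/(val [` iV]%fset) -[j]/(val [` jV]%fset) path_steps_trail (trail_steps zT).
move=> nV; rewrite k_supp; last first.
  by apply: contra nV => /(G'_subgraph.2 _ _)[-> ->].
apply/eqP; rewrite size_eq0; apply: contraNT nV.
rewrite -has_filter => /hasP[m _ /andP[/eqP <- /eqP <-]].
by apply/andP; split; exact: fsvalP.
Qed.

(** The counts vanish off [E'], so every step is an edge of the subgraph and the path stays in [V'];
    its length is then the total of the counts. *)
Lemma admissible_trail y N : admissible nbrs (val i1) k y N -> y 0%N = val o ->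
  (forall m, (m < N)%N -> y m.+1 \in nbrs (y m)) ->
  exists2 z : NN.-tuple V', z \in trails NN kk o i1 &
    N = NN /\ (forall m, (m <= N)%N -> y m = trail_path z m).
Proof.
move=> [yk yN] y0 ynbrs.
have stepE m : (m < N)%N -> E' (y m) (y m.+1).
  move=> mN; apply: contraT => nE.
  have := yk _ _ (ynbrs _ mN); rewrite (k_supp nE) => /eqP.
  rewrite size_eq0 => /eqP/eqP; rewrite -[_ == [::]]negbK -has_filter => /hasPn/(_ m).
  by rewrite mem_iota mN !eqxx => /(_ isT).
have yV m : (m <= N)%N -> y m \in V'.
  case: m => [_|m mN]; first by rewrite y0 fsvalP.
  by have [] := G'_subgraph.2 _ _ (stepE _ mN).
(* The default [o] is not reached for indices up to [N], where the path stays in [V']. *)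
pose f m : V' := insubd o (y m).
have fE m : (m <= N)%N -> val (f m) = y m by move=> mN; rewrite /f val_insubd yV.
have fEq m i : (m <= N)%N -> (f m == i) = (y m == val i).
  by move=> mN; rewrite -fE// (inj_eq val_inj).
pose z := [tuple f m.+1 | m < N].
have zE m : (m <= N)%N -> nth o (o :: z) m = f m.
  case: m => [_|m mN] /=; first by apply: val_inj; rewrite fE// y0.
  by rewrite -(tnth_nth o z (Ordinal mN)) tnth_mktuple.
have stepsE i j : steps o z i j = kk i j.
  rewrite steps_count /kk.
  have -> : count (fun m => (nth o (o :: z) m == i) && (nth o (o :: z) m.+1 == j)) (iota 0 N) =
      path_steps y N (val i) (val j).
    rewrite -size_filter; congr size; apply: eq_in_filter => m; rewrite mem_iota add0n => /andP[_ mN].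
    have mN' : (m <= N)%N := ltnW mN.
    by rewrite (zE _ mN') (zE _ mN) (fEq _ _ mN') (fEq _ _ mN).
  have [ij|ij] := boolP (val j \in nbrs (val i)); first exact: yk.
  rewrite k_supp; last by apply: contra ij => /(G'_subgraph.2 _ _)[].
  apply/eqP; rewrite size_eq0 -[_ == _]negbK -has_filter; apply/hasPn => m.
  rewrite mem_iota add0n => mN; apply: contra ij => /andP[/eqP <- /eqP <-]; exact: ynbrs.
move: z zE stepsE => z zE stepsE.
have NE : N = NN.
  rewrite /NN /row; under eq_bigr do under eq_bigr do rewrite -stepsE.
  rewrite /steps pair_bigA/=.
  transitivity (size (zip (o :: z) z)).
    by rewrite size_zip /= size_tuple; apply/esym/minn_idPr.
  elim: (zip _ _) => [|p s IH] /=; first by rewrite big1.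
  rewrite big_split/= -IH; rewrite (bigD1 p)//= -surjective_pairing eqxx big1 ?addn0// => p' pp'.
  by rewrite -surjective_pairing eq_sym (negPf pp').
have zlast : last o z = i1.
  rewrite -[LHS](nth_last o (o :: z)) [size _]/= size_tuple /= zE//.
  by apply: val_inj; rewrite fE.
have zpath m : (m <= N)%N -> y m = trail_path z m.
  by move=> mN; rewrite /trail_path zE// fE.
have zT : z \in trails N kk o i1.
  rewrite inE zlast eqxx andbT; apply/forallP => i; apply/forallP => j.
  by rewrite stepsE.
by rewrite -NE; exists z.
Qed.

Definition trail_cylinder (z : NN.-tuple V') : set W :=
  cylinder Y S t (trail_path z) NN.

(** The counts ignore steps between non-neighbours, so an admissible sequence need not be a trail;
    it then starts away from [o] or makes a step of jump probability 0. *)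
Lemma null_cylinder y N : admissible nbrs (val i1) k y N ->
  ~ cylinder Y S t y N `<=` \bigcup_(z in [set` trails NN kk o i1]) trail_cylinder z ->
  Q (cylinder Y S t y N) = 0%E.
Proof.
move=> ady nsub.
have mC := @measurable_cylinder _ _ _ _ Y S mY mS t y N.
have le : (Q (cylinder Y S t y N) <=
    Q [set w | forall m, (m <= N)%N -> Y m w = y m /\ ((fun=> 0) m < S m w)%R])%E.
  apply: le_measure; rewrite ?inE//; last by move=> w [Yy _] m mN; split; [exact: Yy|].
  rewrite (_ : [set w | _] = \bigcap_(j < N.+1) (Y j @^-1` [set y j])).
    exact: bigcap_measurableType.
  by apply/seteqP; split => w /= H j jN; [have [] := H j jN|split => //; exact: H].
apply/eqP; rewrite eq_le measure_ge0 andbT (le_trans le)// QYS//.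
rewrite lee_fin; have [y0|/eqP y0] := pselect (y 0%N = val o); last first.
  by rewrite (negPf y0) !mul0r.
have [m mN nm] : exists2 m, (m < N)%N & y m.+1 \notin nbrs (y m).
  apply: contrapT => H; apply: nsub => w cw.
  have [|z zT [NE yz]] := admissible_trail ady y0.
    by move=> m mN; apply: contraT => nm; exfalso; apply: H; exists m.
  exists z => //; move: cw; rewrite NE => -[Yy Jt]; split=> // j jN.
  by rewrite Yy// yz ?NE.
by rewrite (bigD1 (Ordinal mN))//= /jump_prob (negPf nm) mul0r mulr0 mul0r.
Qed.

Definition trail_index n (z : n.-tuple V') (m : nat) : 'I_#|{: V'}| :=
  enum_rank (nth o (o :: z) m).

Lemma tnth_occupation n (idx : nat -> 'I_n) N w a :
  tnth (occupation S idx N w) a = \sum_(m < N) (a == idx m)%:R * S m w.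
Proof.
elim: N => [|N IH] /=; first by rewrite tnth_mktuple big_ord0.
by rewrite tnth_mktuple IH big_ord_recr.
Qed.

(** The final vertex receives the remainder t - J_N, which is exactly the completion of coordinate
    [i1] to total t. *)
Lemma holding_vec_top_up (z : NN.-tuple V') w : z \in trails NN kk o i1 ->
  holding_vec S V' t (trail_path z) NN w =
  top_up (enum_rank i1) t (occupation S (trail_index z) NN w).
Proof.
move=> zT; apply: eq_from_tnth => a.
have eqE m : (trail_path z m == val (enum_val a)) = (a == trail_index z m).
  rewrite /trail_path (inj_eq val_inj) /trail_index -(inj_eq enum_val_inj).
  by rewrite enum_rankK eq_sym.
have lastE : trail_index z NN = enum_rank i1 by rewrite /trail_index (trail_last zT).
rewrite !tnth_mktuple tnth_occupation eqE lastE.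
rewrite occupation_time; congr (_ + _).
by apply: eq_bigr => m _; rewrite eqE.
Qed.

Definition trail_weight : R := \prod_i \prod_j q (val i) (val j) ^+ kk i j.

Hypothesis Bpos : B `<=` positive_orthant R #|{: V'}|.

Lemma trail_jump_prob (z : NN.-tuple V') : z \in trails NN kk o i1 ->
  \prod_(m < NN) jump_prob nbrs q (trail_path z m) (trail_path z m.+1) = trail_weight.
Proof.
move=> zT; rewrite /trail_weight -(trail_prod zT) big_mkord; apply: eq_bigr => m _.
rewrite /jump_prob rate1 divr1 ifT//.
have : (0 < steps o z (nth o (o :: z) m) (nth o (o :: z) m.+1))%N.
  rewrite steps_count -has_count; apply/hasP; exists (m : nat).
    by rewrite mem_iota /=.
  by rewrite !eqxx.
rewrite (trail_steps zT); apply: contraTT => nE.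
rewrite /kk k_supp//; apply: contra nE => /(G'_subgraph.2 _ _)[_ _].
exact.
Qed.

Lemma trail_cylinder_law (z : NN.-tuple V') : z \in trails NN kk o i1 ->
  Q (walk_event nbrs X (val i1) t k B `&` trail_cylinder z) =
  ((trail_weight * expR (- t))%:E *
   Jops (fun=> 0%N) (steps_before (trail_index z) NN)
     (final_hold (enum_rank i1) t B (@hpow R) 0) [tuple 0%R | _ < _])%E.
Proof.
move=> zT.
rewrite -(@path_law _ _ _ _ Q Y S (trail_path z) NN trail_weight _ (trail_index z))//; last first.
  move=> s s0; rewrite QYS// eqxx mul1r trail_jump_prob//.
  congr (_ * _)%:E; rewrite big_mkord; apply: eq_bigr => m _.
  by rewrite rate1 mul1r.
congr (Q _); apply/seteqP; split => w.
  move=> [Aw cw]; have [Yy Jt] := cw; split => //.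
  rewrite -holding_vec_top_up//.
  by have [H _] := walk_event_cylinder G_simple S_gt0 J_unbounded XE (val i1) k B cw; exact: (H Aw).2.
move=> [Yy Jt Bw]; have cw : trail_cylinder z w by split.
split=> //.
apply/(walk_event_cylinder G_simple S_gt0 J_unbounded XE (val i1) k B cw).
by split; [exact: trail_admissible|rewrite holding_vec_top_up].
Qed.

Definition time_density (l : #|{: V'}|.-tuple R) : R :=
  (\prod_(a | a != enum_rank i1)
     (tnth l a ^+ (row kk (enum_val a)).-1 / ((row kk (enum_val a)).-1)`!%:R)) *
  (tnth l (enum_rank i1) ^+ row kk i1 / (row kk i1)`!%:R).

(** Up to a null set the event splits into disjoint pieces, one per trail, which all have the same
    probability. *)
Theorem quenched_walk_event : (forall i, i != i1 -> 0 < row kk i)%N ->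
  Q (walk_event nbrs X (val i1) t k B) =
  ((#|trails NN kk o i1|%:R * trail_weight * expR (- t))%:E *
   \int[simplex_measure (enum_rank i1) t]_(l in B) (time_density l)%:E)%E.
Proof.
move=> row0.
have mC z : measurable (trail_cylinder z) by exact: measurable_cylinder.
have mA := measurable_walk_event G_simple mY mS S_gt0 J_unbounded XE code_inj (val i1) k t_ge0 mB.
rewrite (walk_event_restrict G_simple mY mS S_gt0 J_unbounded XE code_inj t_ge0 mB _
  null_cylinder); last first.
  by apply: fin_bigcup_measurable => // z _; exact: mC.
rewrite setI_bigcupr measure_fin_bigcup//; last 2 first.
- move=> z1 z2 _ _ [w [[_ [Y1 _]] [_ [Y2 _]]]]; apply: eq_from_tnth => a.
  have := Y1 a.+1 (ltn_ord a); rewrite Y2// /trail_path => /val_inj/=.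
  by rewrite !(tnth_nth o).
- by move=> z _; exact: measurableI.
transitivity (\sum_(z \in [set` trails NN kk o i1])
  ((trail_weight * expR (- t))%:E *
   \int[simplex_measure (enum_rank i1) t]_(l in B) (time_density l)%:E))%E.
  apply: eq_fsbigr => z; rewrite inE => /= zT; rewrite trail_cylinder_law//; congr (_ * _)%E.
  have cz a : count_mem a (steps_before (trail_index z) NN) = row kk (enum_val a).
    rewrite count_map -(trail_row zT); apply: eq_count => m /=.
    by rewrite /trail_index -(inj_eq enum_val_inj) enum_rankK.
  have c0 a : a != enum_rank i1 -> (0 < row kk (enum_val a))%N.
    by move=> ai; apply: row0; apply: contraNneq ai => <-; rewrite enum_valK.
  have hE b u : (0 < u)%R -> hpow b u = (u ^+ b / b`!%:R)%R :> R by rewrite /hpow => /ltW ->.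
  rewrite (integral_simplex_measure t (@hpow_ge0 R) (@measurable_hpow R)
    (@hpow_convolution R) hE mB Bpos c0 cz).
  by apply: eq_integral => l _; rewrite enum_rankK.
have -> : [set` trails NN kk o i1] = [set` enum (trails NN kk o i1)].
  by apply/seteqP; split => z /=; rewrite mem_enum.
rewrite -fsbig_seq ?enum_uniq// big_enum/=.
set x := (_ * _)%E; under eq_bigr do rewrite -[x]mul1e.
rewrite -ge0_sume_distrl// sumEFin sumr_const /x muleA -EFinM.
by rewrite mulrA.
Qed.

Theorem quenched_walk_event0 i : i != i1 -> row kk i = 0%N ->
  Q (walk_event nbrs X (val i1) t k B) = 0%E.
Proof.
move=> ii1 ri.
rewrite (walk_event_restrict G_simple mY mS S_gt0 J_unbounded XE code_inj t_ge0 mB _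
  null_cylinder); last first.
  by apply: fin_bigcup_measurable => // z _; exact: measurable_cylinder.
rewrite (_ : _ `&` _ = set0) ?measure0//; apply/seteqP; split => // w [Aw [z /= zT cw]].
have [H _] := walk_event_cylinder G_simple S_gt0 J_unbounded XE (val i1) k B cw.
have [_ /Bpos/(_ (enum_rank i))] := H Aw.
rewrite tnth_mktuple enum_rankK big1 => [|m _].
  rewrite /trail_path (trail_last zT) (inj_eq val_inj) eq_sym (negPf ii1).
  by rewrite mul0r addr0 ltxx.
rewrite (_ : _ == _ = false) ?mul0r//; apply/negbTE; rewrite /trail_path (inj_eq val_inj).
move/eqP: ri; rewrite -(trail_row zT) -[_ == 0%N]negbK -lt0n -has_count => /hasPn.
by apply; rewrite mem_iota/=.
Qed.

End quenched_law.

(** * Averaging over the environment *)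

(** Passes between sums or products over the neighbours of a vertex and over [V'], for quantities
    that are trivial off the edges of the subgraph. *)
Lemma big_fset_support (V : choiceType) (A B : {fset V}) (T : Type) (idx : T)
    (op : Monoid.com_law idx) (f : V -> T) :
  (forall j, (j \in A) != (j \in B) -> f j = idx) ->
  \big[op/idx]_(j <- A) f j = \big[op/idx]_(j : B) f (val j).
Proof.
move=> f0; rewrite -(big_seq_fsetE op B xpredT f)/=.
rewrite (bigID (mem B))/= [X in op _ X]big1_seq ?Monoid.mulm1; last first.
  by move=> j /andP[jB jA]; apply: f0; rewrite jA (negPf jB).
rewrite [RHS](bigID (mem A))/= [X in op _ X]big1_seq ?Monoid.mulm1; last first.
  by move=> j /andP[jA jB]; apply: f0; rewrite jB (negPf jA).
rewrite -big_filter -[RHS]big_filter; apply: perm_big.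
apply: uniq_perm; rewrite ?filter_uniq ?fset_uniq// => j.
by rewrite !mem_filter /= andbC.
Qed.

Section assembly.
Context {R : realType} (V : choiceType) (nbrs : V -> {fset V}).
Hypothesis G_simple : simple_graph nbrs.
Variables (V' : {fset V}) (E' : rel V).
Hypothesis G'_subgraph : subgraph nbrs V' E'.
Variable k : V -> V -> nat.
Hypothesis k_supp : forall i j, ~~ E' i j -> k i j = 0%N.
Local Notation kk := (@fset_counts V V' k).

Lemma edge_support i j : i \in V' -> (j \in nbrs i) != (j \in V') ->
  k i j = 0%N /\ k j i = 0%N.
Proof.
move=> iV nj.
have nE : ~~ E' i j.
  by apply: contra nj => /(G'_subgraph.2 _ _)[_ -> ->].
by split; apply: k_supp; rewrite // G'_subgraph.1.
Qed.

Lemma out_total_row (i : V') : out_total nbrs k (val i) = row kk i.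
Proof.
rewrite /out_total /row; apply: (@big_fset_support _ _ V' _ _ _ (k (val i))) => j jN.
by have [] := edge_support (fsvalP i) jN.
Qed.

Lemma counts_loop (i : V') : kk i i = 0%N.
Proof.
apply: k_supp; apply: contraTN isT => /(G'_subgraph.2 _ _)[_ _].
by rewrite (negPf (G_simple.1 _)).
Qed.

Lemma counts_balanced (o i1 : V') :
  (forall i, i \in V' ->
     divergence nbrs k i = (i == val o)%:Z - (i == val i1)%:Z) ->
  balanced kk o i1.
Proof.
move=> kdiv i; have := kdiv _ (fsvalP i).
rewrite /divergence (@big_fset_support _ _ V' _ _ _ (fun j => (k (val i) j)%:Z - (k j (val i))%:Z)).
  rewrite sumrB !(inj_eq val_inj) /row /col /kk /fset_counts.
  rewrite -!(big_morph Posz PoszD (erefl _)).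
  move: (\sum_j _)%N (\sum_j _)%N => a b.
  by case: (i == o); case: (i == i1) => /= H; lia.
by move=> j /(edge_support (fsvalP i))[-> ->].
Qed.

Lemma trees_of_counts (i1 : V') :
  \sum_(T : {set V' * V'} |
     `[< oriented_spanning_tree (fun i j : V' => E' (val i) (val j)) i1 T >])
         \prod_(a in T) (k (val a.1) (val a.2))%:R = (tree_weight i1 kk)%:R :> R.
Proof.
rewrite -(@sum_oriented_spanning_trees _ (fun i j : V' => E' (val i) (val j))); last first.
  by move=> i j; exact: k_supp.
by rewrite natr_sum; apply: eq_bigr => T _; rewrite natr_prod.
Qed.

Lemma factorial_of_counts (i : V') :
  (\prod_(j <- nbrs (val i)) (k (val i) j)`! = \prod_j (kk i j)`!)%N.
Proof.
apply: (@big_fset_support _ _ V' _ _ _ (fun j => (k (val i) j)`!)) => j jN.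
by have [->] := edge_support (fsvalP i) jN.
Qed.

Lemma monomial_env dE (E : measurableType dE) (omega : E -> V -> V -> R) e (i : V') :
  env nbrs omega (val i) e \in positive_orthant R _ ->
  monomial (fun a => k (val i) (val (enum_val a))) (env nbrs omega (val i) e) =
  \prod_j omega e (val i) (val j) ^+ kk i j.
Proof.
move=> epos; rewrite /monomial indicE epos mulr1.
rewrite -(@big_fset_support _ (nbrs (val i)) V' _ _ _ (fun j => omega e (val i) j ^+ k (val i) j)).
  rewrite big_nbrs; apply: eq_bigr => a _.
  by rewrite tnth_mktuple.
by move=> j /(edge_support (fsvalP i))[-> _]; rewrite expr0.
Qed.

End assembly.

Lemma negligible_exists d (T : measurableType d) (R : realType) (P : probability T R)
    (p : T -> Prop) : {ae P, forall x, p x} -> exists x, p x.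
Proof.
move=> [N [mN N0 pN]]; apply: contrapT => np.
have : N = setT by rewrite -subTset => x _; apply: pN => /= px; apply: np; exists x.
by move=> NT; move/eqP: N0; rewrite NT probability_setT onee_eq0.
Qed.

(** * Cancellation of the factorials *)

Section density_identity.
Context {R : realType} (V : choiceType) (V' : {fset V}) (k : V -> V -> nat) (o i1 : V').
Local Notation kk := (@fset_counts V V' k).
Local Notation NN := (@total_steps V V' k).

Lemma time_densityE (l : #|{: V'}|.-tuple R) :
  time_density i1 k l =
  (\prod_(i | i != i1) (vcoord l i ^+ (row kk i).-1 / ((row kk i).-1)`!%:R)) *
  (vcoord l i1 ^+ row kk i1 / (row kk i1)`!%:R).
Proof.
rewrite /time_density; congr (_ * _).
rewrite (reindex enum_rank); last by apply: onW_bij; exact: enum_rank_bij.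
apply: congr_big => // [i|i _]; first by rewrite (inj_eq enum_rank_inj).
by rewrite enum_rankK.
Qed.

(** No vertex but the root may lack steps, so [fill] does not affect the tree weight. The factorials
    of the Dirichlet moments turn the trail count into [wtrails], and those of the time density
    cancel the ones produced by [wtrailsE]. *)
Lemma trails_density (G e : R) (D : V' -> R) (l : #|{: V'}|.-tuple R) :
  (forall i, kk i i = 0%N) -> balanced kk o i1 ->
  (forall i, i != i1 -> (0 < row kk i)%N) ->
  positive_orthant R _ l ->
  #|trails NN kk o i1|%:R * (\prod_i (G * (\prod_j (kk i j)`!)%N%:R / D i)) * e *
    time_density i1 k l =
  e * G ^+ #|{: V'}| *
  (\prod_i (vcoord l i ^ ((row kk i)%:Z - 1) / D i)) * vcoord l i1 *
  (tree_weight i1 kk)%:R.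
Proof.
move=> kii kb row0 l0.
have fillE : tree_weight i1 (fill i1 kk) = tree_weight i1 kk.
  apply: eq_tree_weight => i j ii1.
  by rewrite /fill gtn_eqF// row0.
have := wtrailsE kii kb (erefl NN); rewrite fillE /wtrails.
move=> /(congr1 (fun m => m%:R : R)); rewrite !natrM => H.
rewrite time_densityE !big_split/= prodr_const -natr_prod.
set P := (\prod_i \prod_j _)%N in H *; set D' := \prod_i (D i)^-1.
rewrite natr_prod in H.
set F := \prod_(i | i != i1) _%:R in H.
have -> : \prod_(i | i != i1) ((row kk i).-1)`!%:R^-1 = F^-1.
  by rewrite /F prodfV.
have F0 : F != 0 by apply/prodf_neq0 => i _; rewrite pnatr_eq0 -lt0n fact_gt0.
have r0 : (row kk i1)`!%:R != 0 :> R by rewrite pnatr_eq0 -lt0n fact_gt0.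
have vi1 : 0 < vcoord l i1 by exact: l0.
set x := \prod_(i | _) _.
(* The root may have no departures, and then its integer exponent is -1; the division is legitimate
   because the coordinate is positive on the orthant. *)
have -> : \prod_i vcoord l i ^ ((row kk i)%:Z - 1) =
    x * vcoord l i1 ^+ row kk i1 / vcoord l i1.
  rewrite (bigD1 i1)//= mulrC -mulrA; congr (_ * _).
    apply: eq_bigr => i ii1.
    rewrite exprnP; congr (_ ^ _); have := row0 _ ii1; lia.
  by rewrite expfzDr ?gt_eqF// exprN1.
have v0 : vcoord l i1 != 0 by rewrite gt_eqF.
move: (vcoord l i1) v0 (F) F0 ((row kk i1)`!%:R : R) r0 H => y y0 F1 F10 f f0 H.
set T := (#|_|%:R); set g := G ^+ _; set yr := y ^+ _.
transitivity (T * P%:R * (g * D' * e * x * F1^-1 * yr / f)); first by ring.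
by rewrite H; field; rewrite y0 F10 f0.
Qed.

End density_identity.

Theorem theorem1p8 (R : realType)
  (V : choiceType) (nbrs : V -> {fset V}) (Delta : nat) (o : V)
  (Delta_gt0 : (0 < Delta)%N)
  (G_simple : simple_graph nbrs)
  (G_regular : regular_graph nbrs Delta)
  (G_connected : connected_on predT (graph_rel nbrs))
  (dE : measure_display) (E : measurableType dE) (P : probability E R)
  (omega : E -> V -> V -> R)
  (omega_dirichlet : dirichlet_environment nbrs P Delta omega)
  (dW : measure_display) (W : measurableType dW) (PW : R.-pker E ~> W)
  (X : R -> W -> V)
  (X_quenched : {ae P, forall e, markov_jump_process nbrs (PW e) (omega e) o X})
  (V' : {fset V}) (E' : rel V)
  (G'_subgraph : subgraph nbrs V' E')
  (G'_connected : connected_on (mem V') E')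
  (o_in_V' : o \in V')
  (i1 : V') (t : R) (t_gt0 : 0 < t)
  (k : V -> V -> nat)
  (k_supp : forall i j, ~~ E' i j -> k i j = 0%N)
  (k_div : forall i, i \in V' ->
     divergence nbrs k i = (i == o)%:Z - (i == val i1)%:Z)
  (B : set (#|{: V'}|.-tuple R))
  (B_measurable : measurable B)
  (B_pos : B `<=` positive_orthant R #|{: V'}|) :
  annealed P PW
    [set w | [/\ jump_counts_eq nbrs X t w k,
                 B (vec (fun i : V' => local_time X t w (val i)))
               & X t w = val i1]] =
  (\int[simplex_measure (enum_rank i1) t]_(l in B)
     (expR (- t) * Gamma (Delta%:R : R) ^+ #|{: V'}| *
      (\prod_(i : V') (vcoord l i ^ ((out_total nbrs k (val i))%:Z - 1) /
                       Gamma ((out_total nbrs k (val i) + Delta)%:R : R))) *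
      vcoord l i1 *
      \sum_(T : {set V' * V'} |
            `[< oriented_spanning_tree (fun i j : V' => E' (val i) (val j)) i1 T >])
         \prod_(a in T) (k (val a.1) (val a.2))%:R)%:E)%E.
Proof.
have [code code_inj] := connected_countable o G_connected.
have t_ge0 : 0 <= t by exact: ltW.
pose oV : V' := [` o_in_V']%fset.
have kb : balanced (@fset_counts V V' k) oV i1.
  by apply: (counts_balanced G'_subgraph k_supp) => i iV; exact: k_div.
pose kk := @fset_counts V V' k.
pose A : set W := walk_event nbrs X (val i1) t k B.
(* As [V'] is finite, almost surely the conditions hold at all its vertices at once. *)
have good : {ae P, forall e, [/\ markov_jump_process nbrs (PW e) (omega e) o X,
    forall i : V', exit_rate nbrs (omega e) (val i) = 1 &
    forall i : V', env nbrs omega (val i) e \in positive_orthant R _]}.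
  have rates : {ae P, forall e, forall i : V', exit_rate nbrs (omega e) (val i) = 1}.
    by apply: filter_forall => i; exact: (exit_rate1 Delta_gt0 G_regular omega_dirichlet).
  have pos : {ae P, forall e, forall i : V', env nbrs omega (val i) e \in positive_orthant R _}.
    by apply: filter_forall => i; exact: (omega_positive Delta_gt0 G_regular omega_dirichlet).
  by apply: filterS3 X_quenched rates pos => e; split.
have mA : measurable A.
  (* [A] does not depend on the environment, so the chain and holding times supplied by a single
     good environment show that it is measurable. *)
  have [e [[Y [S [[mY mS] S0 Jub XE _]]] _ _]] := negligible_exists good.
  exact: (measurable_walk_event G_simple mY mS S0 Jub XE code_inj).
have PWoo e : (PW e setT < +oo)%E by rewrite prob_kernel ltry.
rewrite /annealed -[X in (\int[P]_e PW e X)%E]/A.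
have mPW : measurable_fun setT (fun e => PW e A) by exact: measurable_kernel.
have [row0|] := boolP [forall (i | i != i1), (0 < row kk i)%N]; last first.
  rewrite negb_forall => /existsP[i]; rewrite negb_imply -leqNgt leqn0 => /andP[ii1 /eqP ri].
  rewrite (ge0_ae_eq_integral (g := cst 0%E))//; last first.
    apply: filterS good => e [[Y [S [[mY mS] S0 Jub XE QYS]]] re epos] _.
    exact: (quenched_walk_event0 G_simple mY mS S0 Jub XE code_inj
      (o := oV) QYS t_ge0 B_measurable G'_subgraph k_supp B_pos ii1 ri).
  rewrite integral0; apply/esym/integral0_eq => l _.
  rewrite (trees_of_counts k_supp) [tree_weight _ _]big1 ?mulr0// => f _.
  by rewrite (bigD1 i)//= -/kk (row_eq0 _ ri).
have {}row0 i : i != i1 -> (0 < row kk i)%N.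
  by move=> ii1; move/forall_inP: row0; apply.
pose NN := total_steps V' k.
pose D (i : V') : R := Gamma ((out_total nbrs k (val i) + Delta)%:R : R).
(* [env_independent] takes a function and a mean at every vertex of the graph, so [f] and [m] are
   indexed by all of [V], through neighbours; they are matched with [V'] by [mE] and
   [monomial_env]. *)
pose f i (x : #|{: nbrs i}|.-tuple R) : R := monomial (fun a => k i (val (enum_val a))) x.
pose m i : R := Gamma (Delta%:R : R) *
  (\prod_(a < #|{: nbrs i}|) (k i (val (enum_val a)))`!%:R) /
  Gamma ((\sum_(a < #|{: nbrs i}|) k i (val (enum_val a)) + Delta)%:R : R).
have mE (i : V') : m (val i) = Gamma (Delta%:R : R) * (\prod_j (kk i j)`!)%N%:R / D i.
  rewrite /m /D /out_total -(factorial_of_counts G'_subgraph k_supp) !big_nbrs.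
  by rewrite natr_prod.
have G_gt0 n : (0 < n)%N -> 0 < Gamma (n%:R : R).
  by move=> n0; rewrite -(prednK n0) Gamma_nat ltr0n fact_gt0.
have m_ge0 i : 0 <= m i.
  rewrite /m divr_ge0// ?mulr_ge0 ?prodr_ge0// ltW// G_gt0// addn_gt0 Delta_gt0 orbT//.
have mf i : measurable_fun setT (f i) by exact: measurable_monomial.
have f0 i x : 0 <= f i x by exact: monomial_ge0.
pose K : \bar R := (\int[simplex_measure (enum_rank i1) t]_(l in B) (time_density i1 k l)%:E)%E.
have d0 l : B l -> 0 <= time_density i1 k l.
  move=> /B_pos l0; rewrite /time_density mulr_ge0 ?prodr_ge0// => [a _|];
    by rewrite divr_ge0// exprn_ge0// ltW.
have K0 : (0 <= K)%E by apply: integral_ge0 => l Bl; rewrite lee_fin d0.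
pose C : R := #|trails NN kk oV i1|%:R * expR (- t).
have C0 : 0 <= C by rewrite mulr_ge0// expR_ge0.
have md : measurable_fun setT (time_density i1 k : _ -> R).
  rewrite /time_density; apply: measurable_funM; last first.
    by apply: measurable_funM => //; apply: measurable_funX; exact: measurable_tnth.
  under eq_fun do rewrite -big_filter.
  apply: measurable_prod => a _; apply: measurable_funM => //.
  by apply: measurable_funX; exact: measurable_tnth.
have mprod : measurable_fun setT (fun e => \prod_(i <- V') f i (env nbrs omega i e)).
  by apply: measurable_prod => i _; apply: (measurableT_comp (mf i));
    exact: (measurable_env omega_dirichlet).
(* Almost surely the quenched probability factors into the constants [C] and [K] and the monomials,
   the only part that depends on the environment. *)
rewrite (ge0_ae_eq_integral
  (g := fun e => (C%:E * (\prod_(i <- V') f i (env nbrs omega i e))%:E * K)%E))//; last 3 first.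
- apply: emeasurable_funM => //; apply: emeasurable_funM => //.
  by apply/measurable_EFinP.
- by move=> e _; rewrite !mule_ge0// lee_fin prodr_ge0.
- apply: filterS good => e [[Y [S [[mY mS] S0 Jub XE QYS]]] re epos] _.
  rewrite [LHS](quenched_walk_event (PWoo e) G_simple mY mS S0 Jub XE code_inj
      (o := oV) QYS re t_ge0 B_measurable G'_subgraph k_supp B_pos row0).
  congr (_ * _)%E; rewrite -EFinM; congr EFin; rewrite /C mulrAC; congr (_ * _).
  rewrite big_seq_fsetE/=; apply: eq_bigr => i _.
  by rewrite /f (monomial_env G'_subgraph k_supp (epos i)).
rewrite ge0_integralZr//; last 2 first.
- by apply: emeasurable_funM => //; apply/measurable_EFinP.
- by move=> e _; rewrite mule_ge0// lee_fin prodr_ge0.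
rewrite ge0_integralZl_EFin//; last 2 first.
- by move=> e _; rewrite lee_fin prodr_ge0.
- by apply/measurable_EFinP.
rewrite (env_independent omega_dirichlet (m := m) V' mf f0); last first.
  by move=> i; rewrite (dirichlet_moment Delta_gt0 G_regular omega_dirichlet).
rewrite /K -EFinM -ge0_integralZl_EFin//.
- apply: eq_integral => l /set_mem Bl; congr EFin.
  rewrite (trees_of_counts k_supp).
  rewrite (eq_bigr (fun i => vcoord l i ^ ((row kk i)%:Z - 1) / D i)); last first.
    by move=> i _; rewrite /D -(out_total_row G'_subgraph k_supp).
  rewrite -(trails_density (Gamma (Delta%:R : R)) (expR (- t)) D
    (counts_loop G_simple G'_subgraph k_supp) kb row0 (B_pos _ Bl)).
  congr (_ * _); rewrite /C [RHS]mulrAC; congr (_ * _).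
  by rewrite big_seq_fsetE; apply: eq_bigr => i _; exact: mE.
- by apply/measurable_EFinP; exact: measurable_funTS.
- by rewrite mulr_ge0// prodr_ge0.
Qed.
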